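(* Let $P_A$ be a combinatorial decision problem with $P_A\in\mathsf{NP}$. Then $P_A^{HDRR}$ with a linear number of $xor$-dependencies is in $\Sigma^p_3$.
   Context: A combinatorial decision problem $P_A$ has instances given by a finite universe $U$ and a tuple of relations $R=(R_1,\dots,R_r)$ with $R_1=U$, each a relation built from $U$, with a set $F(R)$ of feasible solutions; YES-instance iff $F(R)\neq\emptyset$. Universe elements and relation tuples are combinatorial elements. A scenario is an instance of $P_A$, obtained by activating/deactivating combinatorial elements (deactivating an element removes every relation element containing it). $H(A,B)=|A\triangle B|$. $P_A^{HDRR}$: given a base scenario $\sigma_0$, a set $\mathsf S$ of recovery scenarios and an integer $\kappa$, decide whether there are a feasible solution $s_0$ of $\sigma_0$ and for every $\sigma\in\mathsf S$ a feasible solution $s_\sigma$ of $\sigma$ with $H(s_0,s_\sigma)\le\kappa$ (over universe elements in the solutions). $xor$-dependency scenarios: the recovery scenario set is encoded by $(E',\{(E_{1,1},E_{1,2}),\dots,(E_{n,1},E_{n,2})\})$ with pairwise disjoint sets of combinatorial elements; it consists of all $\sigma=E'\cup E_1\cup\dots\cup E_n$ with $E_i\in\{E_{i,1},E_{i,2}\}$ for each $i$, where $E'$ is a fixed set of elements common to all scenarios. ''Linear number'' means $n$ is linear in the input size.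
   Formalization: ''P_A in NP'' is taken to mean that, besides the decision problem, the relation ''s is a feasible solution of R'' is also in NP; with only the decision problem in NP the claim fails, since feasibility of a given solution could be undecidable. *)

(* Defs.v *)
From mathcomp Require Import all_boot all_order all_algebra finmap.

Set Implicit Arguments.
Unset Strict Implicit.
Unset Printing Implicit Defensive.

Local Open Scope nat_scope.

(** * Polynomial time and the polynomial hierarchy *)

Definition word := seq bool.

(** The machine model is the WHILE language over binary trees (N. D. Jones,
    "Computability and Complexity").  Every step is a constant number of
    constant-time operations on cons cells, without destructive update, and
    the only test is whether a tree is [Nil]; run with shared cells this is a
    pointer machine, polynomially equivalent to a multitape Turing machine. *)
Inductive tree : Type := Nil | Cons of tree & tree.

Inductive expr : Type :=
| EVar of nat
| ENil
| ECons of expr & expr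
| EHd of expr
| ETl of expr.

Inductive cmd : Type :=
| Assign of nat & expr
| Seq of cmd & cmd
| If of nat & cmd & cmd
| While of nat & cmd.

Definition store := nat -> tree.

Definition upd (s : store) (x : nat) (t : tree) : store :=
  fun y => if y == x then t else s y.

Definition hd_tree (t : tree) : tree := if t is Cons a _ then a else Nil.
Definition tl_tree (t : tree) : tree := if t is Cons _ b then b else Nil.

Fixpoint eval (s : store) (e : expr) : tree :=
  match e with
  | EVar x => s x
  | ENil => Nil
  | ECons a b => Cons (eval s a) (eval s b)
  | EHd a => hd_tree (eval s a)
  | ETl a => tl_tree (eval s a)
  end.

(** [run c s n s']: started in [s], the program [c] halts in [s'] after [n]
    steps.  Expressions have a size fixed by the program, so charging one step
    per assignment affects running times by a constant factor only. *)
Inductive run : cmd -> store -> nat -> store -> Prop :=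
| RunAssign s x e : run (Assign x e) s 1 (upd s x (eval s e))
| RunSeq c1 c2 s1 s2 s3 n1 n2 :
    run c1 s1 n1 s2 -> run c2 s2 n2 s3 -> run (Seq c1 c2) s1 (n1 + n2) s3
| RunIfTrue x c1 c2 s n s' :
    s x <> Nil -> run c1 s n s' -> run (If x c1 c2) s n.+1 s'
| RunIfFalse x c1 c2 s n s' :
    s x = Nil -> run c2 s n s' -> run (If x c1 c2) s n.+1 s'
| RunWhileDone x c s :
    s x = Nil -> run (While x c) s 1 s
| RunWhileStep x c s1 s2 s3 n1 n2 :
    s1 x <> Nil -> run c s1 n1 s2 -> run (While x c) s2 n2 s3 ->
    run (While x c) s1 (n1 + n2).+1 s3.

Definition tree_list (T : Type) (f : T -> tree) (s : seq T) : tree :=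
  foldr (fun a t => Cons (f a) t) Nil s.

Definition tree_bit (b : bool) : tree := if b then Cons Nil Nil else Nil.

Definition tree_word (w : word) : tree := tree_list tree_bit w.

(** The [i]-th input word is in variable [i]; all other variables are [Nil]. *)
Definition init (ws : seq word) : store :=
  fun i => tree_word (nth [::] ws i).

(** [V], a relation on [k] words, is decidable in time polynomial in the total
    length of the words; the answer is read off variable 0. *)
Definition polytime (k : nat) (V : seq word -> Prop) : Prop :=
  exists (c : cmd) (q : {poly nat}), forall ws : seq word, size ws = k ->
    exists (n : nat) (s : store),
      [/\ run c (init ws) n s,
          n <= (q.[sumn (map size ws)])%R
        & (s 0 <> Nil) <-> V ws].

(** [k] alternating quantifiers over words of length at most [m], the first
    one existential iff [ex]. *)
Fixpoint alternate (ex : bool) (k m : nat) (V : seq word -> Prop)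
    (ws : seq word) : Prop :=
  if k is k'.+1 then
    if ex then
      exists y : word, size y <= m /\ alternate false k' m V (rcons ws y)
    else
      forall y : word, size y <= m -> alternate true k' m V (rcons ws y)
  else V ws.

Definition Sigma_p (k : nat) (L : word -> Prop) : Prop :=
  exists (V : seq word -> Prop) (p : {poly nat}),
    polytime k.+1 V /\
    forall x : word, L x <-> alternate true k (p.[size x])%R V [:: x].

Definition NP (L : word -> Prop) : Prop := Sigma_p 1 L.

(** * Combinatorial decision problems *)

(** [Leaf u] is the universe element named [u].  For [2 <= j],
    [Node j [:: e_1; ...; e_m]] is the tuple [(e_1, ..., e_m)] regarded as an
    element of the relation [R_j]; its components may be universe elements,
    tuples of relations, or bare tuples [Node 0 l], which belong to no relation
    and are not combinatorial elements themselves.  [Node 1] is not used, as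
    [R_1] is the universe. *)
Notation elem := (GenTree.tree word).

Definition is_univ (e : elem) : bool := if e is GenTree.Leaf _ then true else false.

(** Everything occurring in [e] ([e] included), except the bare tuples. *)
Fixpoint contained (e : elem) : seq elem :=
  match e with
  | GenTree.Leaf _ => [:: e]
  | GenTree.Node j l =>
      (if j == 0 then [::] else [:: e]) ++ flatten (map contained l)
  end.

Definition tag_ok (r : nat) (e : elem) : bool :=
  if e is GenTree.Node j _ then 1 < j <= r else true.

Definition comb_elem (r : nat) (e : elem) : bool :=
  tag_ok r e && all (tag_ok r) (contained e).

(** A pair [(U, (R_1, ..., R_r))] with [R_1 = U] is identified with the set of
    all its combinatorial elements: [U] is recovered as its set of leaves and
    [R_j] as its set of nodes labelled [j].  That the relations are built from
    [U] means that the set contains whatever its elements contain. *)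
Definition structure_wf (r : nat) (I : {fset elem}) : Prop :=
  forall e, e \in I -> comb_elem r e && all (fun a => a \in I) (contained e).

Record comb_problem : Type := CombProblem {
  nrel : nat;
  nrel_gt0 : 0 < nrel;
  is_instance : {fset elem} -> Prop;
  feasible : {fset elem} -> {fset elem} -> Prop;
  is_instance_wf : forall I, is_instance I -> structure_wf nrel I;
  feasible_sub : forall I S,
    is_instance I -> feasible I S -> (S `<=` I)%fset
}.

(** * Encodings *)

Fixpoint code (t : tree) : word :=
  if t is Cons a b then true :: code a ++ code b else [:: false].

Fixpoint tree_elem (e : elem) : tree :=
  match e with
  | GenTree.Leaf u => Cons Nil (tree_word u)
  | GenTree.Node j l =>
      Cons (Cons Nil (iter j (Cons Nil) Nil))
           (foldr (fun a t => Cons (tree_elem a) t) Nil l)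
  end.

(** A finite set is presented to a machine by any repetition-free list of its
    elements. *)
Definition tree_elems (s : seq elem) : tree := tree_list tree_elem s.

Definition set_of (s : seq elem) : {fset elem} := [fset e in s]%fset.

(** Value of a binary numeral, least significant bit first. *)
Definition bin_val (w : word) : nat := foldr (fun (b : bool) n => b + n.*2) 0 w.

(** * Membership in NP *)

Definition yes_language (P : comb_problem) (w : word) : Prop :=
  exists s : seq elem,
    [/\ w = code (tree_elems s), uniq s, is_instance P (set_of s)
      & exists S, feasible P (set_of s) S].

Definition solution_language (P : comb_problem) (w : word) : Prop :=
  exists s t : seq elem,
    [/\ w = code (Cons (tree_elems s) (tree_elems t)), uniq s && uniq t,
        is_instance P (set_of s) & feasible P (set_of s) (set_of t)].

(** Membership in NP is understood with the feasible solutions as certificates: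
    a proposed solution can itself be verified (in polynomial time, possibly
    with the help of a further short certificate).  The first component alone
    says nothing about which sets are feasible once one of them is, and would
    allow [feasible] to be undecidable. *)
Definition problem_in_NP (P : comb_problem) : Prop :=
  NP (yes_language P) /\ NP (solution_language P).

(** * Hamming distance recoverable robustness *)

Definition hamming (A B : {fset elem}) : nat :=
  #|` [fset e in (A `\` B) `|` (B `\` A) | is_univ e]%fset |.

(** The structure in which exactly the elements outside [A] are deactivated:
    deactivation of an element also removes all elements containing it. *)
Definition scenario (A : {fset elem}) : {fset elem} :=
  [fset e in A | all (fun a => a \in A) (contained e)]%fset.

Definition xor_scenarios (E' : {fset elem})
    (deps : seq ({fset elem} * {fset elem})) (sigma : {fset elem}) : Prop :=
  exists E : seq {fset elem},
    all2 (fun Ei dep => (Ei == dep.1) || (Ei == dep.2)) E deps /\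
    sigma = scenario (E' `|` \bigcup_(Ei <- E) Ei)%fset.

Definition HDRR (P : comb_problem) (sigma0 : {fset elem})
    (S : {fset elem} -> Prop) (kappa : int) : Prop :=
  [/\ is_instance P sigma0,
      forall sigma, S sigma -> is_instance P sigma
    & exists s0, feasible P sigma0 s0 /\
        forall sigma, S sigma ->
          exists s, feasible P sigma s /\ ((hamming s0 s)%:Z <= kappa)%R].

(** Inputs: base scenario [b], common part [e], list [d] of dependencies, and
    sign and binary absolute value of [kappa].  The number of dependencies is
    at most [c] times the input length. *)
Definition HDRR_xor_language (P : comb_problem) (c : nat) (w : word) : Prop :=
  exists (b e : seq elem) (d : seq (seq elem * seq elem))
         (sgn : bool) (m : word),
    let parts := e :: flatten [seq [:: p.1; p.2] | p <- d] in
    let deps := [seq (set_of p.1, set_of p.2) | p <- d] in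
    [/\ w = code (Cons (tree_elems b)
                 (Cons (tree_elems e)
                 (Cons (tree_list (fun p => Cons (tree_elems p.1) (tree_elems p.2)) d)
                 (Cons (tree_bit sgn) (tree_word m))))),
        size d <= c * size w,
        uniq b && all uniq parts,
        all (all (comb_elem (nrel P))) parts
          && pairwise (fun s t => [disjoint set_of s & set_of t]%fset) parts
      & HDRR P (set_of b) (xor_scenarios (set_of e) deps)
          ((-1) ^+ sgn * (bin_val m)%:Z)%R].

(* Main.v *)
(** Write [HDRR] as [exists y1, forall y2, exists y3, V].  The word [y1] holds a
    solution of the base scenario, [y2] selects one alternative per dependency,
    [y3] holds a solution of the resulting scenario; both solutions come with
    the certificate of the NP verifier of [solution_language].  Only the
    polynomial running time of [V] needs work.  The class [fp] of polynomial
    time functions on trees is closed under composition, conditionals and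
    structural recursion, provided that the recursively defined function has
    polynomially bounded size; so [V] can be written as a functional program. *)

Require Import Defs.
From mathcomp Require Import all_boot all_order all_algebra finmap.
From mathcomp Require Import zify.
From Stdlib Require Import ClassicalEpsilon.
(* [Nil] and [Cons] must again denote the constructors of [tree]. *)
Import Defs GRing.Theory.

Set Implicit Arguments.
Unset Strict Implicit.
Unset Printing Implicit Defensive.

Local Open Scope nat_scope.

(** * Polynomial time tree functions *)

(** Since cells are shared, a loop around [Assign 0 (ECons (EVar 0) (EVar 0))] doubles the size of a
    tree in every round. Polynomial time alone therefore does not bound sizes, while the time of a
    subsequent program is measured against the size of its input. This is why [fp] carries a size
    bound of its own and why recursion asks for one. The problem speaks of sets and the machine sees
    lists; moreover [is_instance] and [feasible] may be hard to test. Both are left to the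
    certificates: membership in [solution_language] also ensures that the first component is a
    duplicate-free list presenting an instance. The verifier itself tests only the format of the
    input, the parts [E'] and [E_{i,j}], and the distance. The certificate for a scenario refers to
    one particular list, namely the one that the verifier computes from the choices; disjointness of
    the parts keeps that list free of repetitions. Witnesses stay short because a feasible solution
    is a subset of its instance, and every scenario is selected from the input. *)

Fixpoint tree_size (t : tree) : nat :=
  if t is Cons a b then (tree_size a + tree_size b).+1 else 1.

Lemma tree_size_gt0 t : 0 < tree_size t. Proof. by case: t. Qed.

Lemma tree_size_hd t : tree_size (hd_tree t) <= tree_size t.
Proof. by case: t => [|a b] //=; lia. Qed.

Lemma tree_size_tl t : tree_size (tl_tree t) <= tree_size t.
Proof. by case: t => [|a b] //=; lia. Qed.

Definition truthy (t : tree) : bool := if t is Cons _ _ then true else false.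

Lemma truthyP t : reflect (t <> Nil) (truthy t).
Proof. by case: t => [|a b]; constructor. Qed.

Lemma truthy_bit b : truthy (tree_bit b) = b. Proof. by case: b. Qed.

(** The base is at least 2, so a larger exponent absorbs sums and constants, and no coefficients are
    needed. *)
Definition polyb (f : tree -> nat) : Prop :=
  exists k, forall t, f t <= (tree_size t).+1 ^ k.

Lemma polyb_le f g : (forall t, f t <= g t) -> polyb g -> polyb f.
Proof. by move=> fg [k gk]; exists k => t; apply: leq_trans (fg t) (gk t). Qed.

Lemma polyb_tree_size : polyb tree_size.
Proof. by exists 1 => t; rewrite expn1. Qed.

Lemma polyb_const c : polyb (fun=> c).
Proof.
exists c => t; apply: leq_trans (ltnW (ltn_expl c (ltnSn 1))) _.
by case: c => // c; rewrite leq_exp2r // ltnS tree_size_gt0.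
Qed.

Lemma polyb_mul f g : polyb f -> polyb g -> polyb (fun t => f t * g t).
Proof. by move=> [j fj] [k gk]; exists (j + k) => t; rewrite expnD leq_mul. Qed.

Lemma polyb_add f g : polyb f -> polyb g -> polyb (fun t => f t + g t).
Proof.
move=> [j fj] [k gk]; exists (j + k).+1 => t.
have b2 : 1 < (tree_size t).+1 by rewrite ltnS tree_size_gt0.
have fj' : f t <= (tree_size t).+1 ^ (j + k).
  by apply: leq_trans (fj t) _; rewrite leq_exp2l // leq_addr.
have gk' : g t <= (tree_size t).+1 ^ (j + k).
  by apply: leq_trans (gk t) _; rewrite leq_exp2l // leq_addl.
rewrite expnS; apply: leq_trans (_ : 2 * (tree_size t).+1 ^ (j + k) <= _); first lia.
by rewrite leq_mul2r b2 orbT.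
Qed.

Lemma polyb_exp f k : polyb f -> polyb (fun t => f t ^ k).
Proof.
move=> fP; elim: k => [|k IH]; first exact: polyb_const.
by apply: polyb_le (polyb_mul fP IH) => t; rewrite expnS.
Qed.

Lemma polyb_comp f g : polyb f -> polyb (fun t => tree_size (g t)) ->
  polyb (fun t => f (g t)).
Proof.
move=> [k fk] gP.
apply: polyb_le (polyb_exp k (polyb_add gP (polyb_const 1))) => t.
by rewrite addn1.
Qed.

(** The initial store is arbitrary, so that a program may run after others have left values in its
    scratch variables. Variables above [m] survive and can hold intermediate results when programs
    are combined. *)
Definition computes (c : cmd) (m : nat) (f : tree -> tree) (T : tree -> nat) :=
  forall s, exists n s', [/\ run c s n s', n <= T (s 0), s' 0 = f (s 0)
    & forall y, m < y -> s' y = s y].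

Definition fp (f : tree -> tree) : Prop :=
  polyb (fun t => tree_size (f t)) /\
  exists c m T, polyb T /\ computes c m f T.

Lemma fp_size f : fp f -> polyb (fun t => tree_size (f t)). Proof. by case. Qed.

Lemma fp_eq f g : f =1 g -> fp f -> fp g.
Proof.
move=> fg [fS [c [m [T [TP cP]]]]]; split.
  by apply: polyb_le fS => t; rewrite fg.
exists c, m, T; split=> // s; have [n [s' [r1 r2 r3 r4]]] := cP s.
by exists n, s'; split; rewrite -?fg.
Qed.

Lemma fp_expr f e : (forall s, eval s e = f (s 0)) ->
  polyb (fun t => tree_size (f t)) -> fp f.
Proof.
move=> ef fS; split=> //; exists (Assign 0 e), 0, (fun=> 1).
split=> [|s]; first exact: polyb_const.
exists 1, (upd s 0 (eval s e)); split=> [|//||[]//]; first exact: RunAssign.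
by rewrite /upd /= ef.
Qed.

Lemma fp_id : fp (fun t => t).
Proof. by apply: (@fp_expr _ (EVar 0)) => //; exact: polyb_tree_size. Qed.

Lemma fp_nil : fp (fun=> Nil).
Proof. by apply: (@fp_expr _ ENil) => //; exact: polyb_const. Qed.

Lemma fp_comp f g : fp f -> fp g -> fp (fun t => f (g t)).
Proof.
move=> [fS [cf [mf [Tf [TfP fP]]]]] [gS [cg [mg [Tg [TgP gP]]]]]; split.
  exact: (polyb_comp fS gS).
exists (Seq cg cf), (maxn mf mg), (fun t => Tg t + Tf (g t)); split.
  by apply: polyb_add => //; apply: polyb_comp.
move=> s; have [n1 [s1 [r1 le1 e1 u1]]] := gP s.
have [n2 [s2 [r2 le2 e2 u2]]] := fP s1.
exists (n1 + n2), s2; split.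
- exact: RunSeq r1 r2.
- by rewrite leq_add // -e1.
- by rewrite e2 e1.
by move=> y; rewrite gtn_max => /andP[y1 y2]; rewrite u2 // u1.
Qed.

Lemma fp_hd f : fp f -> fp (fun t => hd_tree (f t)).
Proof.
apply: fp_comp; apply: (@fp_expr _ (EHd (EVar 0))) => //.
exact: polyb_le tree_size_hd polyb_tree_size.
Qed.

Lemma fp_tl f : fp f -> fp (fun t => tl_tree (f t)).
Proof.
apply: fp_comp; apply: (@fp_expr _ (ETl (EVar 0))) => //.
exact: polyb_le tree_size_tl polyb_tree_size.
Qed.

Lemma run_seqA x e c s n s' : run c (upd s x (eval s e)) n s' ->
  run (Seq (Assign x e) c) s n.+1 s'.
Proof. by move=> r; rewrite -add1n; apply: RunSeq r; apply: RunAssign. Qed.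

Lemma fp_cons f g : fp f -> fp g -> fp (fun t => Cons (f t) (g t)).
Proof.
move=> [fS [cf [mf [Tf [TfP fP]]]]] [gS [cg [mg [Tg [TgP gP]]]]]; split.
  apply: polyb_le (polyb_add (polyb_add fS gS) (polyb_const 1)) => t /=.
  by rewrite addn1.
pose m := maxn mf mg; have mfm : mf <= m := leq_maxl _ _.
have mgm : mg <= m := leq_maxr _ _.
(* Neither [cf] nor [cg] changes [m.+1] and [m.+2]: the former keeps the input for [cg], the latter
   the result of [cf]. *)
exists (Seq (Assign m.+1 (EVar 0)) (Seq cf (Seq (Assign m.+2 (EVar 0))
  (Seq (Assign 0 (EVar m.+1)) (Seq cg (Assign 0 (ECons (EVar m.+2) (EVar 0)))))))).
exists m.+2, (fun t => Tf t + Tg t + 4); split.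
  by do !apply: polyb_add => //; apply: polyb_const.
move=> s; pose s1 := upd s m.+1 (s 0).
have [n1 [s2 [r1 le1 e1 u1]]] := fP s1.
pose s2' := upd s2 m.+2 (s2 0); pose s3 := upd s2' 0 (s2' m.+1).
have [n2 [s4 [r2 le2 e2 u2]]] := gP s3.
have s30 : s3 0 = s 0.
  by rewrite /s3 /s2' /upd /= eqn_leq ltnn andbF u1 ?ltnS // /s1 /upd eqxx.
exists (n1 + (n2 + 1).+2).+1, (upd s4 0 (Cons (s4 m.+2) (s4 0))); split.
- apply/run_seqA/(RunSeq r1)/run_seqA/run_seqA/(RunSeq r2).
  exact: RunAssign.
- move: le1 le2; rewrite s30 /s1 /upd /=; lia.
- rewrite {1}/upd /= e2 s30 u2; last lia.
  by rewrite /s3 /s2' /upd /= eqxx e1.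
move=> y my; rewrite /upd; case: eqP => [|_]; first lia.
rewrite u2; last lia.
rewrite /s3 /s2' /upd; case: eqP => [|_]; first lia.
case: eqP => [|_]; first lia.
rewrite u1; last lia.
by rewrite /s1 /upd; case: eqP => //; lia.
Qed.

Definition fpb (p : tree -> bool) : Prop := fp (fun t => tree_bit (p t)).

Lemma fp_if p f g : fpb p -> fp f -> fp g -> fp (fun t => if p t then f t else g t).
Proof.
move=> [_ [cp [mp [Tp [TpP pP]]]]].
move=> [fS [cf [mf [Tf [TfP fP]]]]] [gS [cg [mg [Tg [TgP gP]]]]]; split.
  apply: polyb_le (polyb_add fS gS) => t /=.
  by case: (p t); rewrite ?leq_addr ?leq_addl.
pose m := maxn mp (maxn mf mg); have mpm : mp <= m by rewrite leq_maxl.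
have mfm : mf <= m by rewrite /m; lia.
have mgm : mg <= m by rewrite /m; lia.
exists (Seq (Assign m.+1 (EVar 0)) (Seq cp (Seq (Assign m.+2 (EVar 0))
  (Seq (Assign 0 (EVar m.+1)) (If m.+2 cf cg))))).
exists m.+2, (fun t => Tp t + (Tf t + Tg t) + 4); split.
  by do !apply: polyb_add => //; apply: polyb_const.
move=> s; pose s1 := upd s m.+1 (s 0).
have [n1 [s2 [r1 le1 e1 u1]]] := pP s1.
pose s2' := upd s2 m.+2 (s2 0); pose s3 := upd s2' 0 (s2' m.+1).
have s30 : s3 0 = s 0.
  by rewrite /s3 /s2' /upd /= eqn_leq ltnn andbF u1 ?ltnS // /s1 /upd eqxx.
have s3m : s3 m.+2 = tree_bit (p (s 0)) by rewrite /s3 /s2' /upd /= eqxx e1.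
have s3y y : m.+2 < y -> s3 y = s y.
  move=> my; rewrite /s3 /s2' /upd; case: eqP => [|_]; first lia.
  case: eqP => [|_]; first lia.
  rewrite u1; last lia.
  by rewrite /s1 /upd; case: eqP => //; lia.
have [n2 [s4 [r2 le2 e2 u2]]] : exists n s', [/\ run (If m.+2 cf cg) s3 n s',
    n <= (Tf (s 0) + Tg (s 0)).+1, s' 0 = (if p (s 0) then f (s 0) else g (s 0))
    & forall y, m < y -> s' y = s3 y].
  case: (boolP (p (s 0))) s3m => [_|_] /= s3m.
    have [n [s' [r le e u]]] := fP s3; exists n.+1, s'; split.
    - by apply: RunIfTrue r; rewrite s3m.
    - by rewrite s30 in le; lia.
    - by rewrite e s30.
    by move=> y my; apply: u; lia.
  have [n [s' [r le e u]]] := gP s3; exists n.+1, s'; split.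
  - exact: RunIfFalse r.
  - by rewrite s30 in le; lia.
  - by rewrite e s30.
  by move=> y my; apply: u; lia.
exists (n1 + n2.+2).+1, s4; split=> //.
- by apply/run_seqA/(RunSeq r1)/run_seqA/run_seqA.
- by move: le1 le2; rewrite /s1 /upd /=; lia.
by move=> y my; rewrite u2 ?s3y //; lia.
Qed.

(** A trace of a loop whose guard is the head of the state, with all states of size at most [B]. The
    cap is what turns the time of one round, a polynomial in the current state, into a polynomial in
    the input. *)
Inductive steps (f : tree -> tree) (B : nat) : nat -> tree -> tree -> Prop :=
| Steps0 t : tree_size t <= B -> steps f B 0 t t
| StepsS n t u : tree_size t <= B -> hd_tree t <> Nil -> steps f B n (f t) u ->
    steps f B n.+1 t u.

Lemma steps_trans f B n1 n2 t u v :
  steps f B n1 t u -> steps f B n2 u v -> steps f B (n1 + n2) t v.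
Proof.
elim=> // n t' u' le ne _ IH st; rewrite addSn.
by apply: StepsS (IH st).
Qed.

Lemma fp_while step init g N S : fp step -> fp init -> polyb N -> polyb S ->
  (forall t, hd_tree (g t) = Nil /\
     exists2 n, n <= N t & steps step (S t) n (init t) (g t)) ->
  fp g.
Proof.
move=> [_ [c [m [T [[k TP] cP]]]]] [iS [ci [mi [Ti [TiP iP]]]]] NP SP H.
split.
  apply: polyb_le SP => t; have [_ [n _ st]] := H t.
  by elim: st.
pose M := maxn m mi; have mM : m <= M := leq_maxl _ _.
have miM : mi <= M := leq_maxr _ _.
pose body := Seq c (Assign M.+1 (EHd (EVar 0))).
exists (Seq ci (Seq (Assign M.+1 (EHd (EVar 0))) (While M.+1 body))), M.+1.
(* Each round costs one call of [c] on a state of size at most [S t], one assignment copying the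
   head of the state to the guard variable [M.+1], and one test. The final 2 pays for the first such
   assignment and the last test. *)
exists (fun t => Ti t + N t * ((S t + 1) ^ k + 2) + 2); split.
  do !apply: polyb_add => //; last exact: polyb_const.
  apply: polyb_mul => //; apply: polyb_add; last exact: polyb_const.
  by apply/polyb_exp/polyb_add => //; apply: polyb_const.
have loop B n t u : steps step B n t u -> hd_tree u = Nil ->
    forall s, s 0 = t -> s M.+1 = hd_tree t ->
    exists n' s', [/\ run (While M.+1 body) s n' s',
      n' <= n * ((B + 1) ^ k + 2) + 1, s' 0 = u & forall y, M.+1 < y -> s' y = s y].
  elim=> [{}t le hdt s s0 sM|{}n {}t {}u le ne _ IH hdu s s0 sM].
    by exists 1, s; split=> //; apply: RunWhileDone; rewrite sM.
  have [n1 [s1 [r1 le1 e1 u1]]] := cP s.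
  pose s2 := upd s1 M.+1 (hd_tree (s1 0)).
  have [||n2 [s3 [r2 le2 e2 u2]]] := IH hdu s2.
  - by rewrite /s2 /upd /= e1 s0.
  - by rewrite /s2 /upd eqxx e1 s0.
  exists ((n1 + 1) + n2).+1, s3; split=> //.
  - apply: RunWhileStep r2; first by rewrite sM.
    by apply: RunSeq r1 _; apply: RunAssign.
  - have : n1 <= (B + 1) ^ k.
      apply: leq_trans le1 (leq_trans (TP _) _); rewrite s0.
      by case: (k) => // k'; rewrite leq_exp2r // addn1 ltnS.
    by move: le2; lia.
  move=> y my; rewrite u2 // /s2 /upd; case: eqP => [|_]; first lia.
  by rewrite u1 //; lia.
move=> s; have [n1 [s1 [r1 le1 e1 u1]]] := iP s.
pose s2 := upd s1 M.+1 (hd_tree (s1 0)).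
have [hdg [n le st]] := H (s 0).
have [||n2 [s3 [r2 le2 e2 u2]]] := loop _ _ _ _ st hdg s2.
- by rewrite /s2 /upd.
- by rewrite /s2 /upd eqxx e1.
exists (n1 + n2.+1), s3; split=> //.
- by apply/(RunSeq r1)/run_seqA.
- have : n * ((S (s 0) + 1) ^ k + 2) <= N (s 0) * ((S (s 0) + 1) ^ k + 2).
    by rewrite leq_mul2r le orbT.
  by lia.
move=> y my; rewrite u2 // /s2 /upd; case: eqP => [|_]; first lia.
by rewrite u1 //; lia.
Qed.

(** * Structural recursion *)

Lemma fp_const u : fp (fun=> u).
Proof. by elim: u => [|a IHa b IHb]; [exact: fp_nil | exact: fp_cons]. Qed.

Lemma fpb_truthy f : fp f -> fpb (fun t => truthy (f t)).
Proof.
apply: (@fp_comp (fun t => tree_bit (truthy t))).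
have [_ [c [m [T [TP cP]]]]] := fp_id.
split.
  by apply: polyb_le (polyb_const 3) => t; case: (truthy t).
exists (If 0 (Assign 0 (ECons ENil ENil)) (Assign 0 ENil)), 0, (fun=> 2).
split=> [|s]; first exact: polyb_const.
case E: (s 0) => [|a b].
  exists 2, (upd s 0 Nil); split=> //=; first exact/RunIfFalse/(@RunAssign s 0 ENil).
  by case.
exists 2, (upd s 0 (Cons Nil Nil)); split=> //=; last by case.
by apply: RunIfTrue; [rewrite E | exact: (@RunAssign s 0 (ECons ENil ENil))].
Qed.

Lemma fp_bit p : fpb p -> fp (fun t => tree_bit (p t)). Proof. by []. Qed.

Lemma fpb_const b : fpb (fun=> b). Proof. exact: fp_const. Qed.

Lemma fpb_and p q : fpb p -> fpb q -> fpb (fun t => p t && q t).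
Proof.
move=> pP qP; apply: fp_eq (fp_if pP qP fp_nil) => t.
by case: (p t).
Qed.

Lemma fpb_or p q : fpb p -> fpb q -> fpb (fun t => p t || q t).
Proof.
move=> pP qP; apply: fp_eq (fp_if pP (fpb_const true) qP) => t.
by case: (p t).
Qed.

Lemma fpb_not p : fpb p -> fpb (fun t => ~~ p t).
Proof.
move=> pP; apply: fp_eq (fp_if pP fp_nil (fpb_const true)) => t.
by case: (p t).
Qed.

Create HintDb fp.
#[local] Hint Resolve fp_id fp_nil fp_const fp_hd fp_tl fp_cons fp_if fp_bit
  fpb_truthy fpb_const fpb_and fpb_or fpb_not : fp.

Section TreeRecursion.

(** The parameter [e] may change in the recursive calls, but [k1S] and [k2S] keep the size of
    parameter and argument together from growing. Hence [FB], taken at the initial size, bounds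
    every intermediate value. *)
Variables (F : tree -> tree -> tree) (g0 k1 k2 h : tree -> tree) (c k : nat).
Hypotheses (g0P : fp g0) (k1P : fp k1) (k2P : fp k2) (hP : fp h).
Hypothesis F0 : forall e, F e Nil = g0 e.
Hypothesis FS : forall e a b, let q := Cons e (Cons a b) in
  F e (Cons a b) = h (Cons q (Cons (F (k1 q) a) (F (k2 q) b))).
Hypothesis k1S : forall e a b,
  tree_size (k1 (Cons e (Cons a b))) + tree_size a <= tree_size e + tree_size (Cons a b).
Hypothesis k2S : forall e a b,
  tree_size (k2 (Cons e (Cons a b))) + tree_size b <= tree_size e + tree_size (Cons a b).
Hypothesis FB : forall e t, tree_size (F e t) <= c * (tree_size e + tree_size t) ^ k.

(* A state is a pair of stacks: pending tasks and computed values.  The task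
   [Cons Nil (Cons e t)] asks for [F e t]; the task [Cons (Cons Nil Nil) q]
   combines the two topmost values. *)
Let task e t := Cons Nil (Cons e t).

(** The task for the left subtree is performed first, so at combination time its value lies below
    that of the right subtree. *)
Let step st :=
  let w := hd_tree (hd_tree st) in let ts := tl_tree (hd_tree st) in
  let vs := tl_tree st in let q := tl_tree w in
  if truthy (hd_tree w) then
    Cons ts (Cons (h (Cons q (Cons (hd_tree (tl_tree vs)) (hd_tree vs))))
                  (tl_tree (tl_tree vs)))
  else if truthy (tl_tree q) then
    Cons (Cons (task (k1 q) (hd_tree (tl_tree q)))
         (Cons (task (k2 q) (tl_tree (tl_tree q)))
         (Cons (Cons (Cons Nil Nil) q) ts))) vs
  else Cons ts (Cons (g0 (hd_tree q)) vs).

Let stepP : fp step.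
Proof.
pose w st := hd_tree (hd_tree st); pose q st := tl_tree (w st).
have wP : fp w by rewrite /w; auto with fp.
have qP : fp q by rewrite /q; auto with fp.
have k1qP : fp (fun st => k1 (q st)) by exact: fp_comp.
have k2qP : fp (fun st => k2 (q st)) by exact: fp_comp.
have g0qP : fp (fun st => g0 (hd_tree (q st))) by apply: fp_comp; auto with fp.
have hqP : fp (fun st => h (Cons (q st) (Cons (hd_tree (tl_tree (tl_tree st)))
    (hd_tree (tl_tree st))))).
  by apply: fp_comp => //; auto 10 with fp.
rewrite /step /task; apply: fp_if; first by auto with fp.
  by auto 20 with fp.
by apply: fp_if; auto 20 with fp.
Qed.

(** Every node of [t] reserves a budget [W]. Expanding a node puts three tasks on the stack, each of
    size at most [M] plus a constant, and a finished subtree leaves a value of size at most [R];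
    hence [3 * M + 20 + R]. An inner node is handled twice, for expansion and combination, and a
    leaf once, which gives the factor 2 in the number of steps. *)
Let steps_rec M R B t : forall e ts vs, let W := 3 * M + 20 + R in
  (forall x u, tree_size x + tree_size u <= M -> tree_size (F x u) <= R) ->
  tree_size e + tree_size t <= M -> tree_size ts + tree_size vs + W * tree_size t <= B ->
  exists2 n, n <= 2 * tree_size t
    & steps step B n (Cons (Cons (task e t) ts) vs) (Cons ts (Cons (F e t) vs)).
Proof.
move=> e ts vs W bound; have WE : W = 3 * M + 20 + R by [].
clearbody W; elim: t e ts vs => [|a IHa b IHb] e ts vs /=.
  rewrite muln1 => le1 le2; exists 1 => //.
  have le3 := bound e Nil le1.
  apply: StepsS => //=; first by lia.
  by rewrite F0 in le3 *; apply: Steps0 => /=; lia.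
move=> le1; rewrite -addn1 !mulnDr muln1 => le2.
have Wa : W <= W * tree_size a by rewrite leq_pmulr // tree_size_gt0.
have Wb : W <= W * tree_size b by rewrite leq_pmulr // tree_size_gt0.
have := k1S e a b; have := k2S e a b; have := FS e a b.
set q := Cons e (Cons a b) => /= Fq k2q k1q.
have le3 : tree_size (F (k1 q) a) <= R by apply: bound; lia.
have le4 : tree_size (F (k2 q) b) <= R by apply: bound; lia.
have le5 : tree_size (F e (Cons a b)) <= R by apply: bound => /=; lia.
have [||na lea sta] := IHa (k1 q)
  (Cons (task (k2 q) b) (Cons (Cons (Cons Nil Nil) q) ts)) vs; [lia| |].
  by rewrite /task /=; lia.
have [||nb leb stb] := IHb (k2 q)
  (Cons (Cons (Cons Nil Nil) q) ts) (Cons (F (k1 q) a) vs); [lia| |].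
  by rewrite /=; lia.
exists ((na + (nb + 1)).+1); first by lia.
apply: StepsS => //=; first by lia.
apply: (steps_trans sta); apply: (steps_trans stb); apply: StepsS => //=.
  by lia.
by rewrite Fq in le5 *; apply: Steps0 => /=; lia.
Qed.

Lemma fp_rec : fp (fun p => F (hd_tree p) (tl_tree p)).
Proof.
pose init p := Cons (Cons (task (hd_tree p) (tl_tree p)) Nil) Nil.
pose out p := Cons Nil (Cons (F (hd_tree p) (tl_tree p)) Nil).
suff outP : fp out.
  have -> : (fun p => F (hd_tree p) (tl_tree p)) = (fun p => hd_tree (tl_tree (out p))).
    by [].
  by auto with fp.
pose M p := tree_size (hd_tree p) + tree_size (tl_tree p).
have MP : polyb M.
  by apply: polyb_add; apply: fp_size; auto with fp.
pose W p := 3 * M p + 20 + c * M p ^ k.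
have WP : polyb W.
  apply: polyb_add.
    apply: polyb_add (polyb_const 20); exact: polyb_mul (polyb_const 3) MP.
  by apply: polyb_mul; [exact: polyb_const | exact: polyb_exp].
apply: (@fp_while step init out (fun p => 2 * tree_size (tl_tree p))
  (fun p => 1 + 1 + W p * tree_size (tl_tree p)) stepP).
- by rewrite /init /task; auto 10 with fp.
- apply: polyb_mul; [exact: polyb_const | apply: fp_size; auto with fp].
- apply: polyb_add; first exact: polyb_const.
  by apply: polyb_mul => //; apply: fp_size; auto with fp.
move=> p; split=> //; apply: (@steps_rec (M p) (c * M p ^ k)) => // x u le.
apply: leq_trans (FB _ _) _; rewrite leq_mul2l.
by case: (k) => [|k']; rewrite ?expn0 ?leq_exp2r ?le ?orbT.
Qed.

End TreeRecursion.

Lemma fp_app2 F f g : fp (fun p => F (hd_tree p) (tl_tree p)) ->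
  fp f -> fp g -> fp (fun t => F (f t) (g t)).
Proof. by move=> FP fP gP; apply: (fp_comp FP (fp_cons fP gP)). Qed.

(** The instance of [fp_rec] for lists: the recursive call on the head is made as well, with
    parameter [Nil], and its value is discarded. *)
Lemma fp_list_rec (F : tree -> tree -> tree) (g0 : tree -> tree)
    (k : tree -> tree -> tree -> tree) (h : tree -> tree -> tree -> tree -> tree) c d :
  fp g0 ->
  fp (fun q => k (hd_tree q) (hd_tree (tl_tree q)) (tl_tree (tl_tree q))) ->
  fp (fun p => h (hd_tree (hd_tree p)) (hd_tree (tl_tree (hd_tree p)))
     (tl_tree (tl_tree (hd_tree p))) (tl_tree p)) ->
  (forall e, F e Nil = g0 e) ->
  (forall e a b, F e (Cons a b) = h e a b (F (k e a b) b)) ->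
  (forall e a b, tree_size (k e a b) + tree_size b <= tree_size e + tree_size (Cons a b)) ->
  (forall e t, tree_size (F e t) <= c * (tree_size e + tree_size t) ^ d) ->
  fp (fun p => F (hd_tree p) (tl_tree p)).
Proof.
move=> g0P kP hP F0 FS kS FB.
pose h' p := h (hd_tree (hd_tree p)) (hd_tree (tl_tree (hd_tree p)))
     (tl_tree (tl_tree (hd_tree p))) (tl_tree (tl_tree p)).
apply: (@fp_rec F g0 (fun=> Nil) _ h' c d g0P fp_nil kP) => //=.
  pose pr p := Cons (hd_tree p) (tl_tree (tl_tree p)).
  by apply: (@fp_comp _ pr hP); rewrite /pr; auto with fp.
by move=> e a b; have := tree_size_gt0 e; lia.
Qed.

(** * Trees as a data type *)

Lemma tree_size_bit b : tree_size (tree_bit b) <= 3. Proof. by case: b. Qed.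

(** Encoded Booleans have size at most 3, so the size bound required by [fp_list_rec] comes for
    free. *)
Lemma fpb_list_rec (P : tree -> tree -> bool) (g0 : tree -> bool)
    (k : tree -> tree -> tree -> tree) (h : tree -> tree -> tree -> bool -> bool) :
  fpb g0 ->
  fp (fun q => k (hd_tree q) (hd_tree (tl_tree q)) (tl_tree (tl_tree q))) ->
  fpb (fun p => h (hd_tree (hd_tree p)) (hd_tree (tl_tree (hd_tree p)))
     (tl_tree (tl_tree (hd_tree p))) (truthy (tl_tree p))) ->
  (forall e, P e Nil = g0 e) ->
  (forall e a b, P e (Cons a b) = h e a b (P (k e a b) b)) ->
  (forall e a b, tree_size (k e a b) + tree_size b <= tree_size e + tree_size (Cons a b)) ->
  fpb (fun p => P (hd_tree p) (tl_tree p)).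
Proof.
move=> g0P kP hP P0 PS kS.
apply: (@fp_list_rec (fun e t => tree_bit (P e t)) _ _
  (fun e a b r => tree_bit (h e a b (truthy r))) 3 0 g0P kP hP) => //.
- by move=> e; rewrite P0.
- by move=> e a b; rewrite PS truthy_bit.
by move=> e t; rewrite expn0 muln1 tree_size_bit.
Qed.

(** Only [t] drives the recursion; [u] is taken apart by total projections, as the scheme of
    [fp_rec] demands of a parameter. *)
Fixpoint eqt (u t : tree) : bool :=
  if t is Cons a b then [&& truthy u, eqt (hd_tree u) a & eqt (tl_tree u) b]
  else ~~ truthy u.

Lemma eqtP u t : reflect (u = t) (eqt u t).
Proof.
elim: t u => [|a IHa b IHb] [|c d] /=; try by constructor.
by apply: (iffP andP) => [[/IHa-> /IHb->]|[-> ->]] //; split; [apply/IHa|apply/IHb].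
Qed.

Lemma fpb_eq f g : fp f -> fp g -> fpb (fun t => eqt (f t) (g t)).
Proof.
apply: (@fp_app2 (fun u t => tree_bit (eqt u t))).
pose h p := tree_bit [&& truthy (hd_tree (hd_tree p)), truthy (hd_tree (tl_tree p))
  & truthy (tl_tree (tl_tree p))].
apply: (@fp_rec (fun u t => tree_bit (eqt u t)) (fun u => tree_bit (~~ truthy u))
  (fun q => hd_tree (hd_tree q))
  (fun q => tl_tree (hd_tree q)) h 3 0) => //=; try by auto 10 with fp.
- by rewrite /h; auto 20 with fp.
- by move=> e a b; rewrite /h /= !truthy_bit.
- by move=> e a b; have := tree_size_hd e; lia.
- by move=> e a b; have := tree_size_tl e; lia.
by move=> e t; rewrite expn0 muln1 tree_size_bit.
Qed.
#[local] Hint Resolve fpb_eq : fp.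

Ltac size_le := move=> *; rewrite /= ?expn1;
  try (match goal with e : tree |- _ => have := tree_size_gt0 e; have := tree_size_tl e end); lia.

Fixpoint memt (x l : tree) : bool :=
  if l is Cons a b then eqt x a || memt x b else false.

Lemma fpb_mem f g : fp f -> fp g -> fpb (fun t => memt (f t) (g t)).
Proof.
apply: (@fp_app2 (fun u t => tree_bit (memt u t))).
apply: (@fpb_list_rec memt (fun=> false) (fun e _ _ => e)
  (fun e a _ r => eqt e a || r)) => //=; auto 20 with fp.
by size_le.
Qed.
#[local] Hint Resolve fpb_mem : fp.

Fixpoint catt (t u : tree) : tree :=
  if t is Cons a b then Cons a (catt b u) else u.

Lemma tree_size_cat t u : tree_size (catt t u) <= tree_size t + tree_size u.
Proof. by elim: t => [|a _ b IH] /=; lia. Qed.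

Lemma fp_cat f g : fp f -> fp g -> fp (fun t => catt (f t) (g t)).
Proof.
move=> fP gP; apply: (@fp_app2 (fun u t => catt t u)) gP fP.
apply: (@fp_list_rec (fun u t => catt t u) (fun u => u) (fun e _ _ => e)
  (fun e a _ r => Cons a r) 1 1) => //=; auto 10 with fp.
  by size_le.
by move=> e t; rewrite expn1 mul1n addnC tree_size_cat.
Qed.
#[local] Hint Resolve fp_cat : fp.

(** * Conversion between trees and their binary codes *)

Fixpoint enct (t : tree) : tree :=
  if t is Cons a b then Cons (tree_bit true) (catt (enct a) (enct b))
  else Cons (tree_bit false) Nil.

Lemma tree_size_enc t : tree_size (enct t) <= 8 * tree_size t.
Proof. by elim: t => [|a IHa b IHb] //=; have := tree_size_cat (enct a) (enct b); lia. Qed.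

Lemma fp_enc f : fp f -> fp (fun t => enct (f t)).
Proof.
apply: (@fp_app2 (fun=> enct) (fun t => t)); last exact: fp_id.
apply: (@fp_rec (fun=> enct) (fun=> enct Nil) (fun q => hd_tree q) (fun q => hd_tree q)
   (fun p => Cons (tree_bit true) (catt (hd_tree (tl_tree p)) (tl_tree (tl_tree p))))
   8 1) => //=; auto 10 with fp.
- by size_le.
- by size_le.
by move=> e t; have := tree_size_enc t; rewrite expn1; lia.
Qed.
#[local] Hint Resolve fp_enc : fp.

(* Polish notation read from right to left with a stack of trees; the stack
   underflows harmlessly, [hd_tree] and [tl_tree] being total. *)
Fixpoint dect (w : tree) : tree :=
  if w is Cons a b then
    let st := dect b in
    if truthy a then Cons (Cons (hd_tree st) (hd_tree (tl_tree st))) (tl_tree (tl_tree st))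
    else Cons Nil st
  else Nil.

Lemma tree_size_dec t : tree_size (dect t) <= 4 * tree_size t.
Proof.
elim: t => [|a _ b IH] //=; have := tree_size_gt0 a.
by case: (truthy a) => /=; case: (dect b) IH => [|x [|y z]] /=; lia.
Qed.

Lemma fp_dec f : fp f -> fp (fun t => dect (f t)).
Proof.
apply: (@fp_app2 (fun=> dect) (fun t => t)); last exact: fp_id.
apply: (@fp_list_rec (fun=> dect) (fun=> Nil) (fun e _ _ => e)
  (fun e a _ st => if truthy a then
     Cons (Cons (hd_tree st) (hd_tree (tl_tree st))) (tl_tree (tl_tree st))
     else Cons Nil st) 4 1) => //=; auto 20 with fp.
  by size_le.
by move=> e t; have := tree_size_dec t; rewrite expn1; lia.
Qed.
#[local] Hint Resolve fp_dec : fp.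

Fixpoint word_of (t : tree) : word :=
  if t is Cons a b then truthy a :: word_of b else [::].

Lemma tree_wordK : cancel tree_word word_of.
Proof. by elim=> //= b w ->; rewrite truthy_bit. Qed.

Lemma fp_word_of f : fp f -> fp (fun t => tree_word (word_of (f t))).
Proof.
apply: (@fp_app2 (fun=> fun t => tree_word (word_of t)) (fun t => t)); last exact: fp_id.
apply: (@fp_list_rec (fun=> fun t => tree_word (word_of t)) (fun=> Nil) (fun e _ _ => e)
  (fun e a _ r => Cons (tree_bit (truthy a)) r) 4 1) => //=; auto 20 with fp.
  by size_le.
move=> e t; rewrite expn1; elim: t => [|a _ b IH] //=; first by lia.
by have := tree_size_bit (truthy a); lia.
Qed.
#[local] Hint Resolve fp_word_of : fp.

(** * Arithmetic on unary numerals *)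

Definition unary (n : nat) : tree := iter n (Cons Nil) Nil.

Fixpoint lent (t : tree) : nat := if t is Cons a b then (lent b).+1 else 0.

Lemma lent_unary n : lent (unary n) = n.
Proof. by elim: n => //= n ->. Qed.

Lemma tree_size_unary n : tree_size (unary n) = n.*2.+1.
Proof. by elim: n => //= n IH; rewrite IH; lia. Qed.

Lemma lent_size t : (lent t).*2 < tree_size t.
Proof. by elim: t => //= a _ b IH; have := tree_size_gt0 a; lia. Qed.

(** In unary the size bound contained in [fp] is a bound on the value, so sums, products and fixed
    polynomials stay in the class. *)
Definition fpn (f : tree -> nat) : Prop := fp (fun t => unary (f t)).

Lemma fp_unary f : fpn f -> fp (fun t => unary (f t)). Proof. by []. Qed.

Lemma fpn_const n : fpn (fun=> n). Proof. exact: fp_const. Qed.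

Lemma fpn_len f : fp f -> fpn (fun t => lent (f t)).
Proof.
apply: (@fp_app2 (fun=> fun t => unary (lent t)) (fun t => t)); last exact: fp_id.
apply: (@fp_list_rec (fun=> fun t => unary (lent t)) (fun=> Nil) (fun e _ _ => e)
  (fun e a _ r => Cons Nil r) 1 1) => //=; auto 20 with fp.
  by size_le.
by move=> e t; rewrite expn1 tree_size_unary; have := lent_size t; lia.
Qed.
#[local] Hint Resolve fp_unary fpn_const fpn_len : fp.

Lemma catt_unary m n : catt (unary m) (unary n) = unary (m + n).
Proof. by elim: m => //= m ->. Qed.

Lemma fpn_add f g : fpn f -> fpn g -> fpn (fun t => f t + g t).
Proof.
move=> fP gP; apply: fp_eq (fp_cat fP gP) => t; exact: catt_unary.
Qed.

Lemma fpn_mul f g : fpn f -> fpn g -> fpn (fun t => f t * g t).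
Proof.
move=> fP gP.
have mulP : fp (fun p => unary (lent (hd_tree p) * lent (tl_tree p))).
  apply: (@fp_list_rec (fun e t => unary (lent e * lent t)) (fun=> Nil) (fun e _ _ => e)
    (fun e a _ r => catt (unary (lent e)) r) 1 2) => //=; auto 20 with fp.
  - by move=> e; rewrite muln0.
  - by move=> e a b; rewrite mulnS catt_unary.
  - by size_le.
  move=> e t; rewrite tree_size_unary mul1n -mulnn.
  have := lent_size t; have := lent_size e; nia.
apply: fp_eq (@fp_app2 (fun u t => unary (lent u * lent t)) _ _ mulP fP gP) => t.
by rewrite !lent_unary.
Qed.

Lemma fpb_leq f g : fpn f -> fpn g -> fpb (fun t => f t <= g t).
Proof.
move=> fP gP.
have leP : fpb (fun p => lent (tl_tree p) <= lent (hd_tree p)).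
  apply: (@fpb_list_rec (fun e t => lent t <= lent e) (fun=> true) (fun e _ _ => tl_tree e)
    (fun e a _ r => truthy e && r)) => //=; auto 20 with fp.
  - by case.
  by move=> e *; have := tree_size_tl e; lia.
apply: fp_eq (@fp_app2 (fun u t => tree_bit (lent t <= lent u)) _ _ leP gP fP) => t.
by rewrite !lent_unary.
Qed.

Lemma fpn_min f g : fpn f -> fpn g -> fpn (fun t => minn (f t) (g t)).
Proof.
move=> fP gP; apply: fp_eq (fp_if (fpb_leq fP gP) fP gP) => t.
by case: leqP.
Qed.
#[local] Hint Resolve fpn_add fpn_mul fpb_leq fpn_min : fp.

Lemma fpn_poly (p : {poly nat}) f : fpn f -> fpn (fun t => (p.[f t])%R).
Proof.
move=> fP; elim/poly_ind: p => [|p c IH].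
  by apply: fp_eq (fpn_const 0) => t; rewrite horner0.
apply: fp_eq (fpn_add (fpn_mul IH fP) (fpn_const c)) => t.
by rewrite hornerMXaddC.
Qed.

(** If [h <= n], both sides equal [h]. Hence a recursion that doubles at each digit may truncate at
    the cap [h] before doubling. *)
Lemma minn_double_add c n h : minn (c + n.*2) h = minn (c + (minn n h).*2) h.
Proof. by lia. Qed.

(* Binary numerals are only evaluated up to a unary cap, which keeps the
   result small. *)
Lemma fpn_bin_val f g : fp f -> fpn g ->
  fpn (fun t => minn (bin_val (word_of (f t))) (g t)).
Proof.
move=> fP gP.
have binP : fp (fun p => unary (minn (bin_val (word_of (tl_tree p))) (lent (hd_tree p)))).
  apply: (@fp_list_rec (fun e t => unary (minn (bin_val (word_of t)) (lent e)))
    (fun=> Nil) (fun e _ _ => e) (fun e a _ r =>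
      unary (minn ((if truthy a then 1 else 0) + (lent r + lent r)) (lent e))) 1 1) => //=.
  - exact: fp_nil.
  - by auto with fp.
  - apply: fp_unary; apply: fpn_min; last by auto 10 with fp.
    apply: fpn_add; last by auto 10 with fp.
    apply: (@fp_eq (fun p => tree_bit (truthy (hd_tree (tl_tree (hd_tree p)))))).
      by move=> p /=; case: (truthy _).
    by auto 10 with fp.
  - by move=> e; rewrite min0n.
  - by move=> e a b; rewrite lent_unary addnn minn_double_add; case: (truthy a).
  - by size_le.
  move=> e t; rewrite tree_size_unary; have := lent_size e; lia.
apply: fp_eq (@fp_app2 (fun u t => unary (minn (bin_val (word_of t)) (lent u)))
  _ _ binP gP fP) => t.
by rewrite !lent_unary.
Qed.

(** * List operations, and tests by mutual recursion on elements and lists of elements *)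

Fixpoint filtert (p : tree -> bool) (l : tree) : tree :=
  if l is Cons a b then if p a then Cons a (filtert p b) else filtert p b else Nil.

Lemma tree_size_filter p l : tree_size (filtert p l) <= tree_size l.
Proof. by elim: l => //= a _ b IH; case: (p a) => /=; lia. Qed.

Lemma fp_filter (p : tree -> tree -> bool) f g :
  fpb (fun q => p (hd_tree q) (tl_tree q)) -> fp f -> fp g ->
  fp (fun t => filtert (p (f t)) (g t)).
Proof.
move=> pP; apply: (@fp_app2 (fun e l => filtert (p e) l)).
apply: (@fp_list_rec (fun e l => filtert (p e) l) (fun=> Nil) (fun e _ _ => e)
  (fun e a _ r => if p e a then Cons a r else r) 1 1) => //=; auto 20 with fp.
- apply: fp_if; auto 10 with fp.
  by apply: (@fp_app2 (fun e a => tree_bit (p e a)) _ _ pP); auto 10 with fp.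
- by size_le.
by move=> e t; rewrite expn1 mul1n; have := tree_size_filter (p e) t; lia.
Qed.

Fixpoint allt (p : tree -> bool) (l : tree) : bool :=
  if l is Cons a b then p a && allt p b else true.

Lemma fpb_all (p : tree -> bool) f : fpb p -> fp f -> fpb (fun t => allt p (f t)).
Proof.
move=> pP; apply: (@fp_app2 (fun=> fun l => tree_bit (allt p l)) (fun t => t)); last exact: fp_id.
apply: (@fpb_list_rec (fun=> allt p) (fun=> true) (fun e _ _ => e)
  (fun e a _ r => p a && r)) => //=; auto 20 with fp.
- apply: fpb_and; auto 10 with fp.
  by apply: (@fp_comp (fun t => tree_bit (p t))); auto 10 with fp.
by size_le.
Qed.

Fixpoint uniqt (l : tree) : bool :=
  if l is Cons a b then ~~ memt a b && uniqt b else true.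

Lemma fpb_uniq f : fp f -> fpb (fun t => uniqt (f t)).
Proof.
apply: (@fp_app2 (fun=> fun l => tree_bit (uniqt l)) (fun t => t)); last exact: fp_id.
apply: (@fpb_list_rec (fun=> uniqt) (fun=> true) (fun e _ _ => e)
  (fun e a b r => ~~ memt a b && r)) => //=; auto 20 with fp.
by size_le.
Qed.
#[local] Hint Resolve fpb_uniq : fp.

(** The mode [m] tells whether a tree is read as an element ([false]) or as a list ([true]). Such a
    mutual recursion becomes an ordinary one by computing the answers for both modes at every node;
    the pair has size at most 7. *)
Lemma fpb_rec2 (P : bool -> tree -> tree -> bool)
    (g : bool -> tree -> bool) (h : bool -> tree -> tree -> tree -> bool -> bool -> bool) :
  (forall m, fpb (g m)) ->
  (forall m, fpb (fun p => h m (hd_tree (hd_tree p)) (hd_tree (tl_tree (hd_tree p)))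
     (tl_tree (tl_tree (hd_tree p))) (truthy (hd_tree (tl_tree p)))
       (truthy (tl_tree (tl_tree p))))) ->
  (forall m e, P m e Nil = g m e) ->
  (forall m e a b, P m e (Cons a b) = h m e a b (P false e a) (P true e b)) ->
  forall m f1 f2, fp f1 -> fp f2 -> fpb (fun t => P m (f1 t) (f2 t)).
Proof.
move=> gP hP P0 PS m f1 f2.
apply: (@fp_app2 (fun e t => tree_bit (P m e t))).
pose F e t := Cons (tree_bit (P false e t)) (tree_bit (P true e t)).
suff FP : fp (fun p => F (hd_tree p) (tl_tree p)).
  case: m; [have := fp_tl FP | have := fp_hd FP]; exact.
pose sel p := Cons (hd_tree p) (Cons (hd_tree (hd_tree (tl_tree p)))
  (tl_tree (tl_tree (tl_tree p)))).
have selP : fp sel by rewrite /sel; auto 10 with fp.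
pose h' m p := tree_bit (h m (hd_tree (hd_tree p)) (hd_tree (tl_tree (hd_tree p)))
     (tl_tree (tl_tree (hd_tree p))) (truthy (hd_tree (tl_tree p)))
       (truthy (tl_tree (tl_tree p)))).
apply: (@fp_rec F (fun e => Cons (tree_bit (g false e)) (tree_bit (g true e)))
  hd_tree hd_tree (fun p => Cons (h' false (sel p)) (h' true (sel p))) 7 0); auto 10 with fp.
- by apply: fp_cons; apply: fp_comp => //; exact: hP.
- by move=> e; rewrite /F !P0.
- by move=> e a b; rewrite /F !PS /h' /= !truthy_bit.
- by size_le.
- by size_le.
move=> e t; rewrite expn0 /F /=.
have := tree_size_bit (P false e t); have := tree_size_bit (P true e t); lia.
Qed.

(* [closedt false A t]: the element represented by [t] and everything it
   contains belong to the list [A]; [closedt true] does this for a list. *)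
Fixpoint closedt (islist : bool) (A t : tree) : bool :=
  if t is Cons a b then
    if islist then closedt false A a && closedt true A b
    else (eqt a (Cons Nil Nil) || memt t A) && (~~ truthy a || closedt true A b)
  else true.

Lemma fpb_closed m f g : fp f -> fp g -> fpb (fun t => closedt m (f t) (g t)).
Proof.
apply: (@fpb_rec2 _ (fun _ _ => true) (fun m A a b r1 r2 =>
  if m then r1 && r2
  else (eqt a (Cons Nil Nil) || memt (Cons a b) A) && (~~ truthy a || r2))) => //.
  by auto with fp.
by case; auto 20 with fp.
Qed.

(* The analogue of [closedt] for the shape of elements: [tags] lists the
   admissible labels. *)
Fixpoint wft (islist : bool) (tags t : tree) : bool :=
  if t is Cons a b then
    if islist then wft false tags a && wft true tags b
    else if truthy a then memt a tags && wft true tags b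
    else eqt b (tree_word (word_of b))
  else islist.

Lemma fpb_wf m f g : fp f -> fp g -> fpb (fun t => wft m (f t) (g t)).
Proof.
apply: (@fpb_rec2 _ (fun m _ => m) (fun m tags a b r1 r2 =>
  if m then r1 && r2
  else if truthy a then memt a tags && r2 else eqt b (tree_word (word_of b)))) => //.
  by auto with fp.
case; auto 20 with fp.
apply: fp_eq (_ : fp (fun p => if truthy (hd_tree (tl_tree (hd_tree p))) then _ else _)).
  by move=> p; rewrite (fun_if tree_bit).
by apply: fp_if; auto 20 with fp.
Qed.

Fixpoint flattent (d : tree) : tree :=
  if d is Cons p d' then catt (hd_tree p) (catt (tl_tree p) (flattent d')) else Nil.

Lemma fp_flatten f : fp f -> fp (fun t => flattent (f t)).
Proof.
apply: (@fp_app2 (fun=> fun l => flattent l) (fun t => t)); last exact: fp_id.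
apply: (@fp_list_rec (fun=> flattent) (fun=> Nil) (fun e _ _ => e)
  (fun e p b r => catt (hd_tree p) (catt (tl_tree p) r)) 2 1) => //=; auto 20 with fp.
  by size_le.
move=> e t; rewrite expn1; elim: t => [|a _ b IH] /=; first lia.
have := tree_size_cat (hd_tree a) (catt (tl_tree a) (flattent b)).
have := tree_size_cat (tl_tree a) (flattent b).
by have := tree_size_hd a; have := tree_size_tl a; lia.
Qed.

(** The head of an exhausted [y] is [Nil], so missing choices select the second alternative, and
    surplus choices are ignored. Thus every word encodes a legitimate selection and its length needs
    no test. *)
Fixpoint selectt (y d : tree) : tree :=
  if d is Cons p d' then
    catt (if truthy (hd_tree y) then hd_tree p else tl_tree p) (selectt (tl_tree y) d')
  else Nil.

Lemma tree_size_select y d : tree_size (selectt y d) <= tree_size d.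
Proof.
elim: d y => [|p _ d IH] y //=; set u := if _ then _ else _.
have := tree_size_cat u (selectt (tl_tree y) d); have := IH (tl_tree y).
have : tree_size u <= tree_size p by rewrite /u; case: ifP; rewrite ?tree_size_hd ?tree_size_tl.
lia.
Qed.

Lemma fp_select f g : fp f -> fp g -> fp (fun t => selectt (f t) (g t)).
Proof.
apply: fp_app2.
apply: (@fp_list_rec selectt (fun=> Nil) (fun e _ _ => tl_tree e)
  (fun e p b r => catt (if truthy (hd_tree e) then hd_tree p else tl_tree p) r) 1 1) => //=;
  auto 20 with fp.
  by move=> e *; have := tree_size_tl e; lia.
by move=> e t; rewrite expn1; have := tree_size_select e t; lia.
Qed.
#[local] Hint Resolve fp_flatten fp_select : fp.

(** * Running a given verifier *)

Lemma size_word_of t : size (word_of t) = lent t.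
Proof. by elim: t => //= a _ b ->. Qed.

Lemma polyb_horner (p : {poly nat}) f : polyb f -> polyb (fun t => (p.[f t])%R).
Proof.
move=> fP; elim/poly_ind: p => [|p c IH].
  by apply: polyb_le (polyb_const 0) => t; rewrite horner0.
apply: polyb_le (polyb_add (polyb_mul IH fP) (polyb_const c)) => t.
by rewrite hornerMXaddC.
Qed.

Lemma polyb_len f : fp f -> polyb (fun t => lent (f t)).
Proof. by move=> /fp_size; apply: polyb_le => t; have := lent_size (f t); lia. Qed.

Fixpoint expr_bound (e : expr) : nat :=
  match e with
  | EVar x => x.+1
  | ENil => 0
  | ECons a b => maxn (expr_bound a) (expr_bound b)
  | EHd a | ETl a => expr_bound a
  end.

Fixpoint cmd_bound (c : cmd) : nat :=
  match c with
  | Assign x e => maxn x.+1 (expr_bound e)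
  | Seq c1 c2 => maxn (cmd_bound c1) (cmd_bound c2)
  | If x c1 c2 => maxn x.+1 (maxn (cmd_bound c1) (cmd_bound c2))
  | While x c => maxn x.+1 (cmd_bound c)
  end.

Lemma eval_frame M s s1 e : (forall y, y < M -> s y = s1 y) ->
  expr_bound e <= M -> eval s e = eval s1 e.
Proof.
move=> E; elim: e => [x||a IHa b IHb|a IH|a IH] //=; first exact: E.
- by rewrite geq_max => /andP[/IHa-> /IHb->].
- by move=> /IH ->.
- by move=> /IH ->.
Qed.

(** A program neither reads nor writes variables beyond those it mentions. This transfers the run of
    a given verifier from the store [init], for which alone it is known, to a store with other data
    in high variables. *)
Lemma run_frame M c s n s' : run c s n s' -> cmd_bound c <= M ->
  forall s1, (forall y, y < M -> s y = s1 y) ->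
  exists s1', [/\ run c s1 n s1', forall y, y < M -> s' y = s1' y
    & forall y, M <= y -> s1' y = s1 y].
Proof.
elim=> {c s n s'} /=.
- move=> s x e; rewrite geq_max => /andP[xM eM] s1 E.
  exists (upd s1 x (eval s1 e)); split=> [|y yM|y My]; first exact: RunAssign.
    by rewrite /upd (eval_frame E eM) E.
  by rewrite /upd; case: eqP => // yx; lia.
- move=> c1 c2 s s' s'' n1 n2 _ IH1 _ IH2; rewrite geq_max => /andP[M1 M2] s1 E.
  have [s1' [r1 E1 u1]] := IH1 M1 s1 E.
  have [s2' [r2 E2 u2]] := IH2 M2 s1' E1.
  exists s2'; split=> // [|y My]; first exact: RunSeq r1 r2.
  by rewrite u2 ?u1.
- move=> s x c1 c2 n s' sx _ IH; rewrite !geq_max => /and3P[xM M1 _] s1 E.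
  have [s1' [r1 E1 u1]] := IH M1 s1 E.
  by exists s1'; split=> //; apply: RunIfTrue => //; rewrite -E.
- move=> s x c1 c2 n s' sx _ IH; rewrite !geq_max => /and3P[xM _ M2] s1 E.
  have [s1' [r1 E1 u1]] := IH M2 s1 E.
  by exists s1'; split=> //; apply: RunIfFalse => //; rewrite -E.
- move=> x c s sx; rewrite geq_max => /andP[xM _] s1 E.
  by exists s1; split=> //; apply: RunWhileDone; rewrite -E.
move=> x c s s' s'' n1 n2 sx _ IH1 _ IH2; rewrite geq_max => /andP[xM cM] s1 E.
have [s1' [r1 E1 u1]] := IH1 cM s1 E.
have [|s2' [r2 E2 u2]] := IH2 _ s1' E1; first by rewrite geq_max xM.
exists s2'; split=> // [|y My]; first by apply: RunWhileStep r1 r2; rewrite -E.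
by rewrite u2 ?u1.
Qed.

(** Variables 0 and 1 are spared, since they hold the two words given to the verifier. *)
Fixpoint clear (M : nat) : cmd :=
  if M is M'.+1 then Seq (Assign M'.+2 ENil) (clear M') else Assign 2 ENil.

Lemma run_clear M s : exists s', run (clear M) s M.+1 s' /\
  (forall y, s' y = if 1 < y <= maxn M.+1 2 then Nil else s y).
Proof.
elim: M s => [|M IH] s.
  exists (upd s 2 Nil); split=> [|y]; first exact: (@RunAssign s 2 ENil).
  by rewrite /upd; congr (if _ then _ else _); lia.
have [s' [r E]] := IH (upd s M.+2 Nil).
exists s'; split=> [|y]; first exact/(@run_seqA _ ENil).
rewrite E /upd; case: eqP => [->|]; case: ifP => //; case: ifP => //; lia.
Qed.

(** The verifier is specified only on a store holding two words and [Nil] elsewhere. Arbitrary trees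
    are therefore first normalised to words, and the variables from 2 up to beyond those of the
    verifier are cleared before it starts. As [V] is a proposition, its Boolean form [acc] comes
    from classical logic; the program shows that it is computable. *)
Lemma fpb_polytime (V : seq word -> Prop) : polytime 2 V ->
  exists2 acc : tree -> tree -> bool,
    forall u z, acc u z <-> V [:: word_of u; word_of z]
    & forall f g, fp f -> fp g -> fpb (fun t => acc (f t) (g t)).
Proof.
move=> [c [q cP]].
pose acc u z : bool := if excluded_middle_informative (V [:: word_of u; word_of z])
  then true else false.
have accP u z : acc u z <-> V [:: word_of u; word_of z].
  by rewrite /acc; case: excluded_middle_informative.
exists acc => // f g fP gP.
pose norm t := Cons (tree_word (word_of (hd_tree t))) (tree_word (word_of (tl_tree t))).
suff aP : fp (fun p => tree_bit (acc (hd_tree p) (tl_tree p))).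
  exact: (@fp_app2 (fun u z => tree_bit (acc u z))).
have normP : fp norm by rewrite /norm; auto 10 with fp.
have [_ [cn [mn [Tn [TnP nP]]]]] := normP.
split; first by apply: polyb_le (polyb_const 3) => t; exact: tree_size_bit.
pose M := maxn (cmd_bound c) 3.
pose bit0 := If 0 (Assign 0 (ECons ENil ENil)) (Assign 0 ENil).
pose T t := (q.[(lent (hd_tree t) + lent (tl_tree t))%N])%R.
exists (Seq cn (Seq (Assign 1 (ETl (EVar 0))) (Seq (Assign 0 (EHd (EVar 0)))
  (Seq (clear M) (Seq c bit0))))).
exists (maxn mn M.+1), (fun t => Tn t + T t + (M + 5)); split.
  apply: polyb_add (polyb_const _); apply: polyb_add => //; apply: polyb_horner.
  by apply: polyb_add; apply: polyb_len; auto with fp.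
move=> s; have [n1 [s1 [r1 le1 e1 u1]]] := nP s.
pose s2 := upd s1 1 (tl_tree (s1 0)); pose s3 := upd s2 0 (hd_tree (s2 0)).
have [s4 [r4 e4]] := run_clear M s3.
set u := word_of (hd_tree (s 0)); set z := word_of (tl_tree (s 0)).
have [|n5 [s5 [r5 le5 e5]]] := cP [:: u; z]; first by [].
have [||s6 [r6 e6 u6]] := run_frame r5 (_ : _ <= M) (s1 := s4).
- by rewrite leq_maxl.
- move=> [|[|y]] yM; rewrite e4 /init /s3 /s2 /upd /= ?e1 //.
  by rewrite nth_nil ifT //; lia.
pose s7 := upd s6 0 (tree_bit (truthy (s6 0))).
have r7 : run bit0 s6 2 s7.
  rewrite /s7; case E: (s6 0) => [|a b].
    exact/RunIfFalse/(@RunAssign _ 0 ENil).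
  by apply: RunIfTrue; [rewrite E | exact: (@RunAssign _ 0 (ECons ENil ENil))].
exists (n1 + (M.+1 + (n5 + 2)).+2), s7; split.
- by apply/(RunSeq r1)/run_seqA/run_seqA/(RunSeq r4)/(RunSeq r6).
- move: le5; rewrite /T /= addn0 /u /z !size_word_of; move: (q.[_])%R => Q; lia.
- rewrite /s7 /upd /= -e6; last by rewrite /M; lia.
  congr tree_bit; apply/idP/idP.
    by move/truthyP/e5/accP.
  by move/accP/e5/truthyP.
move=> y My; rewrite /s7 /upd; case: eqP => [|_]; first lia.
rewrite u6; last lia.
rewrite e4 /s3 /s2 /upd; case: ifP => [|_]; first lia.
case: eqP => [|_]; first lia; case: eqP => [|_]; first lia.
by rewrite u1 //; lia.
Qed.

Lemma tree_size_word w : tree_size (tree_word w) <= 4 * size w + 1.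
Proof. by elim: w => //= b w IH; have := tree_size_bit b; rewrite -/tree_word; lia. Qed.

Lemma affine_exp_poly a b d : exists p : {poly nat}, forall n, (p.[n])%R = (a * n + b) ^ d.
Proof.
elim: d => [|d [p pE]]; first by exists 1%R => n; rewrite hornerC.
exists (a%:P * (p * 'X) + b%:P * p)%R => n.
rewrite hornerD !hornerCM hornerMX pE expnS mulnDl -mulnA [n * _]mulnC.
by [].
Qed.

Lemma polytime_fpb k (p : tree -> bool) : fpb p ->
  polytime k (fun ws => p (tree_list tree_word ws)).
Proof.
move=> [_ [c [m [T [[d TP] cP]]]]].
pose pack n i := foldr (fun x e => ECons (EVar x) e) ENil (iota i n).
have packE ws n i : i + n = size ws ->
    eval (init ws) (pack n i) = tree_list tree_word (drop i ws).
  elim: n i => [|n IH] i ik /=; first by rewrite drop_oversize // -ik addn0.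
  by rewrite (drop_nth [::]) ?(IH i.+1) //= -ik; lia.
(* A letter takes at most 4 nodes; each of the [k] words adds its final [Nil] and the cell holding
   it; the last 2 stands for the [Nil] ending the list of words and the successor in [polyb]. *)
have [q qE] := affine_exp_poly 4 (2 * k + 2) d.
exists (Seq (Assign 0 (pack k 0)) c), (1 + q)%R => ws wsk.
have [n [s [r le e _]]] := cP (upd (init ws) 0 (eval (init ws) (pack k 0))).
exists n.+1, s; split; first exact: run_seqA.
  have size_le : (tree_size (tree_list tree_word ws)).+1 <=
      4 * sumn (map size ws) + (2 * k + 2).
    rewrite -wsk; elim: (ws) => //= w ws' IH.
    by have := tree_size_word w; lia.
  move: le; rewrite {1}/upd /= packE // drop0 => le.
  rewrite hornerD hornerC qE; apply: leq_ltn_trans (leq_trans le (TP _)) _.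
  rewrite ltnS; apply: leq_trans (_ : _ <= (4 * sumn (map size ws) + (2 * k + 2)) ^ d) _.
    by case: (d) => // d'; rewrite leq_exp2r.
  by [].
rewrite e /upd /= packE // drop0.
by case: (p _); split.
Qed.

(** * Encodings *)

Section ListEncoding.

Variables (T : eqType) (f : T -> tree).

Lemma catt_list s s' : catt (tree_list f s) (tree_list f s') = tree_list f (s ++ s').
Proof. by elim: s => //= x s ->. Qed.

Lemma allt_list p s : allt p (tree_list f s) = all (fun x => p (f x)) s.
Proof. by elim: s => //= x s ->. Qed.

Lemma filtert_list p s :
  filtert p (tree_list f s) = tree_list f [seq x <- s | p (f x)].
Proof. by elim: s => //= x s ->; case: (p _). Qed.

Lemma lent_list s : lent (tree_list f s) = size s.
Proof. by elim: s => //= x s ->. Qed.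

Lemma memt_list_ex t s : memt t (tree_list f s) -> exists x, t = f x.
Proof. by elim: s => //= x s IH /orP[/eqtP ->|/IH //]; exists x. Qed.

Hypothesis f_inj : injective f.

Lemma eqt_inj x y : eqt (f x) (f y) = (x == y).
Proof. by apply/eqtP/eqP => [/f_inj|->]. Qed.

Lemma memt_list x s : memt (f x) (tree_list f s) = (x \in s).
Proof. by elim: s => //= y s ->; rewrite eqt_inj in_cons. Qed.

Lemma uniqt_list s : uniqt (tree_list f s) = uniq s.
Proof. by elim: s => //= x s ->; rewrite memt_list. Qed.

(** The size of an encoded list is a sum over its entries, hence independent of their order, and [t]
    is a permutation of a filtered [s]. *)
Lemma tree_size_list_sub s t : uniq s -> uniq t -> {subset t <= s} ->
  tree_size (tree_list f t) <= tree_size (tree_list f s).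
Proof.
have sizeE u : tree_size (tree_list f u) = 1 + \sum_(x <- u) (tree_size (f x)).+1.
  by elim: u => [|x u /= ->]; rewrite ?big_nil // big_cons; lia.
move=> us ut ts; rewrite !sizeE leq_add2l.
rewrite (perm_big [seq x <- s | x \in t]) /=; last first.
  apply: uniq_perm => // [|x]; first exact: filter_uniq.
  by rewrite mem_filter; case: (boolP (x \in t)) => // /ts ->.
by rewrite big_filter big_mkcond; apply: leq_sum => x _; case: ifP.
Qed.

End ListEncoding.

Lemma enct_code t : enct t = tree_word (code t).
Proof. by elim: t => //= a -> b ->; rewrite catt_list. Qed.

Lemma size_code t : size (code t) = tree_size t.
Proof. by elim: t => //= a IHa b IHb; rewrite size_cat IHa IHb. Qed.

Lemma dect_code t w : dect (tree_word (code t ++ w)) = Cons t (dect (tree_word w)).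
Proof. by elim: t w => //= a IHa b IHb w; rewrite -catA IHa IHb. Qed.

Lemma dect_codeK t : hd_tree (dect (tree_word (code t))) = t.
Proof. by rewrite -[code t]cats0 dect_code. Qed.

Lemma code_inj : injective code.
Proof. by move=> t u E; rewrite -[t]dect_codeK E dect_codeK. Qed.

(* The tree read as an element and as a list of elements. *)
Fixpoint elem_of (t : tree) : elem * seq elem :=
  if t is Cons a b then
    ((if a is Cons _ j then GenTree.Node (lent j) (elem_of b).2
      else GenTree.Leaf (word_of b)), (elem_of a).1 :: (elem_of b).2)
  else (GenTree.Leaf [::], [::]).

(** The premise has the form of the induction hypothesis that [GenTree.tree] supplies for the
    children of a node. *)
Lemma tree_elemsK_all (l : seq elem) :
  foldr (fun e => and ((elem_of (tree_elem e)).1 = e)) True l ->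
  (elem_of (tree_elems l)).2 = l.
Proof. by elim: l => //= e l IH [-> /IH ->]. Qed.

Lemma tree_elemK : cancel tree_elem (fun t => (elem_of t).1).
Proof.
elim=> [w|j l IH] /=; first by rewrite tree_wordK.
by rewrite -/(unary j) lent_unary -/(tree_elems l) tree_elemsK_all.
Qed.

Lemma tree_elem_inj : injective tree_elem.
Proof. exact: can_inj tree_elemK. Qed.

Lemma tree_elemsK : cancel tree_elems (fun t => (elem_of t).2).
Proof. by move=> l; apply: tree_elemsK_all; elim: l => //= e l; rewrite tree_elemK. Qed.

Lemma tree_elems_inj : injective tree_elems.
Proof. exact: can_inj tree_elemsK. Qed.

Lemma unary_inj : injective unary.
Proof. exact: can_inj lent_unary. Qed.

(** The labels 2 to [r] of the proper relations, together with 0 for bare tuples. The leading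
    [Cons Nil] is the mark by which [tree_elem] distinguishes nodes from leaves. *)
Definition tag_trees (r : nat) : tree :=
  tree_list (fun j => Cons Nil (unary j)) (0 :: iota 2 r.-1).

Lemma tag_inj : injective (fun j => Cons Nil (unary j)).
Proof. by move=> i j [/unary_inj]. Qed.

Lemma mem_tag_trees r j : memt (Cons Nil (unary j)) (tag_trees r) = (j == 0) || (1 < j <= r).
Proof.
rewrite (memt_list tag_inj) in_cons mem_iota; congr (_ || _); lia.
Qed.

Lemma tag_treesP r t : memt t (tag_trees r) -> exists j, t = Cons Nil (unary j).
Proof. exact: memt_list_ex. Qed.

Lemma all_flatten (T : Type) (p : pred T) ss : all p (flatten ss) = all (all p) ss.
Proof. by elim: ss => //= s ss <-; rewrite all_cat. Qed.

Lemma all_tag_ok_node r j l : all (tag_ok r) (contained (GenTree.Node j l)) =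
  ((j == 0) || (1 < j <= r)) && all (fun e => all (tag_ok r) (contained e)) l.
Proof.
rewrite /= all_cat all_flatten all_map; congr (_ && _).
by case: (j =P 0) => //= _; rewrite andbT.
Qed.

Lemma wft_list r l : wft true (tag_trees r) (tree_elems l) =
  all (fun e => wft false (tag_trees r) (tree_elem e)) l.
Proof. by elim: l => //= e l ->. Qed.

Lemma foldr_and_all (p q : pred elem) (l : seq elem) :
  foldr (fun e => and (p e = q e)) True l -> all p l = all q l.
Proof. by elim: l => //= e l IH [-> /IH ->]. Qed.

Lemma wft_elem r e : wft false (tag_trees r) (tree_elem e) = all (tag_ok r) (contained e).
Proof.
elim: e => [w|j l IH]; first by rewrite /= tree_wordK; apply/eqtP.
rewrite all_tag_ok_node -mem_tag_trees -(foldr_and_all IH) -wft_list.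
by [].
Qed.

(** A tree passing the test is the encoding of something, not merely decodable: leaves must carry
    normalised words, and labels must literally occur in [tag_trees]. *)
Lemma wftK r m t : wft m (tag_trees r) t ->
  if m then tree_elems (elem_of t).2 = t else tree_elem (elem_of t).1 = t.
Proof.
elim: t m => [|a IHa b IHb] [] //=; first by move=> /andP[/IHa -> /IHb ->].
case: a {IHa} => [/eqtP bE|x y] /=; first by congr Cons.
move=> /andP[/tag_treesP[j [-> ->]] /IHb bE].
by rewrite lent_unary -[in RHS]bE.
Qed.

(** Bare tuples are allowed inside an element but not at its root, hence the second test, against
    the label 0. *)
Definition combt (r : nat) (t : tree) : bool :=
  wft false (tag_trees r) t && ~~ eqt (hd_tree t) (Cons Nil Nil).

Lemma combt_elem r e : combt r (tree_elem e) = comb_elem r e.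
Proof.
rewrite /combt wft_elem /comb_elem andbC.
case: e => [w|j l] //; rewrite -[hd_tree _]/(Cons Nil (unary j)).
rewrite -[Cons Nil Nil]/(Cons Nil (unary 0)) (eqt_inj tag_inj) all_tag_ok_node /=.
by case: j => [|j] //=; rewrite andbA andbb.
Qed.

Lemma combtK r l : allt (combt r) l -> tree_elems (elem_of l).2 = l.
Proof. by elim: l => //= a _ b IH /andP[/andP[/wftK -> _] /IH ->]. Qed.

Lemma fpb_comb r f : fp f -> fpb (fun t => combt r (f t)).
Proof. by move=> fP; apply: fpb_and; [apply: fpb_wf|]; auto 10 with fp. Qed.

Lemma closedt_elem A e :
  closedt false (tree_elems A) (tree_elem e) = all (fun a => a \in A) (contained e).
Proof.
elim: e => [w|j l IH].
  by rewrite [LHS]/= andbT (memt_list tree_elem_inj (GenTree.Leaf w)) /= andbT.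
have listE : closedt true (tree_elems A) (tree_elems l) =
    all (fun e => closedt false (tree_elems A) (tree_elem e)) l.
  by elim: l {IH} => //= e l ->.
rewrite -[LHS]/((eqt (Cons Nil (unary j)) (Cons Nil (unary 0))
  || memt (tree_elem (GenTree.Node j l)) (tree_elems A)) &&
  closedt true (tree_elems A) (tree_elems l)).
rewrite (eqt_inj tag_inj) (memt_list tree_elem_inj) listE (foldr_and_all IH).
rewrite [in RHS]/= all_cat all_flatten all_map; congr (_ && _).
by case: (j =P 0) => //= _; rewrite andbT.
Qed.

Lemma mem_set_of (l : seq elem) e : (e \in set_of l) = (e \in l).
Proof. by rewrite /set_of !inE. Qed.

Lemma scenario_list (l : seq elem) :
  scenario (set_of l) = set_of [seq e <- l | all (fun a => a \in l) (contained e)].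
Proof.
apply/fsetP=> e; rewrite mem_set_of mem_filter /scenario !inE /= ?mem_set_of andbC; congr (_ && _).
by apply: eq_all => a; rewrite mem_set_of.
Qed.

(** * Dependencies, their scenarios, and the Hamming distance, in terms of lists *)

Definition tree_deps (d : seq (seq elem * seq elem)) : tree :=
  tree_list (fun p => Cons (tree_elems p.1) (tree_elems p.2)) d.

Definition dep_parts (d : seq (seq elem * seq elem)) : seq (seq elem) :=
  flatten [seq [:: p.1; p.2] | p <- d].

Definition dep_sets (d : seq (seq elem * seq elem)) :=
  [seq (set_of p.1, set_of p.2) | p <- d].

Lemma flattent_deps d : flattent (tree_deps d) = tree_elems (flatten (dep_parts d)).
Proof.
by elim: d => //= p d ->; rewrite /tree_elems !catt_list.
Qed.

Fixpoint select (w : word) (d : seq (seq elem * seq elem)) : seq elem :=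
  if d is p :: d' then (if head false w then p.1 else p.2) ++ select (behead w) d'
  else [::].

Lemma selectt_deps w d :
  selectt (tree_word w) (tree_deps d) = tree_elems (select w d).
Proof.
elim: d w => //= p d IH w.
have -> : tl_tree (tree_word w) = tree_word (behead w) by case: w.
have -> : truthy (hd_tree (tree_word w)) = head false w by case: w => //= b w; rewrite truthy_bit.
by rewrite IH -[tree_elems (_ ++ _)]catt_list; case: (head _ _).
Qed.

Lemma set_of_nil : set_of [::] = fset0.
Proof. by apply/fsetP=> x; rewrite mem_set_of in_fset0. Qed.

Lemma set_of_cat (s t : seq elem) : set_of (s ++ t) = (set_of s `|` set_of t)%fset.
Proof. by apply/fsetP=> x; rewrite inE !mem_set_of mem_cat. Qed.

(** A choice of alternatives is recorded by one bit per dependency. The bound on [size w] places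
    these words within the range of the universal quantifier. *)
Lemma xor_scenariosP (e : seq elem) d sigma :
  xor_scenarios (set_of e) (dep_sets d) sigma <->
  exists2 w, size w <= size d & sigma = scenario (set_of (e ++ select w d)).
Proof.
(* The induction on [d] concerns only the union of the chosen alternatives; the common part and the
   deactivation are added outside. *)
suff H (A : {fset elem}) : (exists2 E : seq {fset elem},
      all2 (fun Ei dep => (Ei == dep.1) || (Ei == dep.2)) E (dep_sets d)
      & A = \bigcup_(Ei <- E) Ei)%fset <->
    exists2 w, size w <= size d & A = set_of (select w d).
  split=> [[E [Eok ->]]|[w wd ->]].
    have [w wd wE] := (H _).1 (ex_intro2 _ _ E Eok erefl).
    by exists w => //; rewrite wE -set_of_cat.
  have [E Eok EE] := (H _).2 (ex_intro2 _ _ w wd erefl).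
  by exists E; split=> //; rewrite -EE -set_of_cat.
elim: d A => [|p d IH] A /=.
  split=> [[[|//] _ ->]|[w _ ->]]; first by exists [::]; rewrite ?big_nil ?set_of_nil.
  by exists [::]; rewrite ?big_nil ?set_of_nil.
split=> [[[//|X E] /= /andP[Xp Eok] ->]|[w wd ->]].
  have [w wd wE] := (IH _).1 (ex_intro2 _ _ E Eok erefl).
  exists ((X == set_of p.1) :: w) => //=; rewrite big_cons wE set_of_cat.
  by case: eqP Xp => [-> _|_ /eqP ->].
have [|E Eok EE] := (IH (set_of (select (behead w) d))).2.
  by exists (behead w) => //; rewrite size_behead; lia.
exists (set_of (if head false w then p.1 else p.2) :: E).
  by rewrite /= Eok andbT; case: (head _ _); rewrite eqxx ?orbT.
by rewrite big_cons -EE set_of_cat.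
Qed.

(** Reduces the two conditions on the parts of an input to one test for repetitions in their
    concatenation. *)
Lemma uniq_flatten_disjoint (ss : seq (seq elem)) : uniq (flatten ss) =
  all uniq ss && pairwise (fun s t => [disjoint set_of s & set_of t]%fset) ss.
Proof.
elim: ss => //= s ss IH; rewrite cat_uniq IH -!andbA; congr (_ && _).
rewrite [in RHS]andbCA; congr (_ && _).
rewrite -all_predC all_flatten; apply: eq_all => t.
apply/allP/fdisjointP => st x; first rewrite !mem_set_of.
  by move=> xs; apply/negP => /st /=; rewrite xs.
move=> xt /=; apply/negP => xs; have := st x.
by rewrite !mem_set_of xt => /(_ xs).
Qed.

Definition ham_list (s t : seq elem) : nat :=
  size [seq x <- s | is_univ x && (x \notin t)] +
  size [seq x <- t | is_univ x && (x \notin s)].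

Lemma hamming_list s t : uniq s -> uniq t ->
  hamming (set_of s) (set_of t) = ham_list s t.
Proof.
move=> us ut; rewrite /hamming /ham_list -size_cat.
set l := _ ++ _.
have lu : uniq l.
  rewrite cat_uniq !filter_uniq //= andbT; apply/hasPn => x.
  by rewrite !mem_filter => /andP[/andP[_ /negPf xs] _]; rewrite xs andbF.
rewrite -[in RHS](undup_id lu) -card_fseq; congr (#|` _|)%fset.
apply/fsetP=> x; rewrite !inE /= !mem_filter.
by case: (is_univ x); case: (x \in s); case: (x \in t).
Qed.

(** * The verifier *)

Lemma horner_leq (p : {poly nat}) m n : m <= n -> (p.[m])%R <= (p.[n])%R.
Proof.
move=> mn; elim/poly_ind: p => [|p c IH]; first by rewrite !horner0.
by rewrite !hornerMXaddC; apply: leq_add => //; apply: leq_mul.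
Qed.

Definition decode_word (x : tree) : tree := hd_tree (dect x).

Notation field0 t := (hd_tree t).
Notation field1 t := (hd_tree (tl_tree t)).
Notation field2 t := (hd_tree (tl_tree (tl_tree t))).
Notation field3 t := (hd_tree (tl_tree (tl_tree (tl_tree t)))).
Notation field4 t := (tl_tree (tl_tree (tl_tree (tl_tree t)))).

(** Decoding never fails, so malformed inputs are detected by encoding the result again and
    comparing. The base scenario [field0 t] is not examined here, its certificate vouches for it.
    For [0 < c] the linear bound holds because each dependency occupies nodes of the encoding; for
    [c = 0] it says that there is no dependency. *)
Definition input_ok (r c : nat) (x : tree) : bool :=
  let t := decode_word x in
  let parts := catt (field1 t) (flattent (field2 t)) in
  [&& eqt x (enct (Cons (field0 t) (Cons (field1 t) (Cons (field2 t)
        (Cons (field3 t) (field4 t)))))),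
      allt truthy (field2 t), allt (combt r) parts, uniqt parts,
      (0 < c) || ~~ truthy (field2 t),
      eqt (field3 t) (tree_bit (truthy (field3 t)))
    & eqt (field4 t) (tree_word (word_of (field4 t)))].

Lemma fpb_input_ok r c f : fp f -> fpb (fun t => input_ok r c (f t)).
Proof.
move=> fP; rewrite /input_ok /decode_word.
have tP : fp (fun t => hd_tree (dect (f t))) by auto with fp.
repeat apply: fpb_and; try (apply: fpb_all || idtac); auto 20 with fp.
by apply: fpb_comb; exact: fp_id.
Qed.

Lemma allt_cat p t u : allt p (catt t u) = allt p t && allt p u.
Proof. by elim: t => //= a _ b ->; rewrite andbA. Qed.

(** [flattent] reads an entry [Nil] like the pair of two empty lists, whose encoding is
    [Cons Nil Nil]; the test [truthy] excludes this ambiguity. *)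
Lemma tree_deps_of r t : allt truthy t -> allt (combt r) (flattent t) ->
  exists d, t = tree_deps d.
Proof.
elim: t => [|p _ t IH] /=; first by exists [::].
move=> /andP[p_ok /IH{}IH]; rewrite !allt_cat => /and3P[/combtK p1 /combtK p2 /IH[d ->]].
exists (((elem_of (hd_tree p)).2, (elem_of (tl_tree p)).2) :: d) => /=.
by rewrite p1 p2; case: p p_ok {p1 p2}.
Qed.

Lemma size_deps d : (size d).*2 < tree_size (tree_deps d).
Proof. by have := lent_size (tree_deps d); rewrite lent_list. Qed.

Lemma input_okP r c w : input_ok r c (tree_word w) <->
  exists tb e d sgn m, [/\ w = code (Cons tb (Cons (tree_elems e) (Cons (tree_deps d)
       (Cons (tree_bit sgn) (tree_word m))))),
    size d <= c * size w, uniq (flatten (e :: dep_parts d))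
    & all (all (comb_elem r)) (e :: dep_parts d)].
Proof.
have flatE e d : catt (tree_elems e) (flattent (tree_deps d)) =
    tree_elems (flatten (e :: dep_parts d)).
  by rewrite flattent_deps catt_list.
have combE (s : seq elem) : allt (combt r) (tree_elems s) = all (comb_elem r) s.
  by rewrite allt_list; apply: eq_all => x; exact: combt_elem.
split=> [|[tb [e [d [sgn [m [-> dc u co]]]]]]].
  rewrite /input_ok; set t := decode_word _.
  move=> /and5P[/eqtP wE dt pt pu /and3P[c0 /eqtP sE /eqtP mE]].
  have /andP[/combtK eE /(tree_deps_of dt)[d dE]] :
    allt (combt r) (field1 t) && allt (combt r) (flattent (field2 t)).
    by rewrite -allt_cat.
  exists (field0 t), (elem_of (field1 t)).2, d, (truthy (field3 t)), (word_of (field4 t)).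
  rewrite -sE -mE eE -dE; split.
  - by apply: (can_inj tree_wordK); rewrite -enct_code.
  - move: c0; rewrite dE; case: (posnP c) => [->|c0 _]; first by case: (d).
    have := congr1 word_of wE; rewrite enct_code !tree_wordK => ->.
    rewrite size_code dE; apply: leq_trans (leq_pmull _ c0) => /=.
    by have := size_deps d; lia.
  - by move: pu; rewrite -{1}eE dE flatE (uniqt_list tree_elem_inj).
  - by move: pt; rewrite -{1}eE dE flatE combE all_flatten.
have eqt_refl x : eqt x x by apply/eqtP.
rewrite /input_ok /decode_word dect_codeK -enct_code; set t := Cons tb _.
apply/andP; split; first exact: eqt_refl.
rewrite -[field1 t]/(tree_elems e) -[field2 t]/(tree_deps d) -[field3 t]/(tree_bit sgn).
rewrite -[field4 t]/(tree_word m) flatE combE all_flatten co (uniqt_list tree_elem_inj) u.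
rewrite truthy_bit tree_wordK !eqt_refl allt_list all_predT !andbT /=.
by case: c dc => //; rewrite mul0n leqn0 size_eq0 => /eqP ->.
Qed.

(* Nothing is known about [acc] on certificates longer than [p] allows, hence
   the length test. *)
Definition certifies (acc : tree -> tree -> bool) (p : {poly nat}) (s t z : tree) : bool :=
  (lent z <= (p.[lent (enct (Cons s t))])%R) && acc (enct (Cons s t)) z.

Lemma fpb_certifies acc p f g h :
  (forall f g, fp f -> fp g -> fpb (fun t => acc (f t) (g t))) ->
  fp f -> fp g -> fp h -> fpb (fun t => certifies acc p (f t) (g t) (h t)).
Proof.
move=> accP fP gP hP; apply: fpb_and; last by apply: accP; auto with fp.
by apply: fpb_leq; [auto with fp | apply: fpn_poly; auto with fp].
Qed.

Definition scenariot (l : tree) : tree := filtert (closedt false l) l.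

Lemma fp_scenario f : fp f -> fp (fun t => scenariot (f t)).
Proof.
by move=> fP; apply: fp_filter => //; apply: fpb_closed; auto with fp.
Qed.

Definition scenario_seq (l : seq elem) : seq elem :=
  [seq e <- l | all (fun a => a \in l) (contained e)].

Lemma scenariot_list l : scenariot (tree_elems l) = tree_elems (scenario_seq l).
Proof.
rewrite /scenariot filtert_list; congr tree_elems.
by apply: eq_filter => e; rewrite closedt_elem.
Qed.

Definition hamt (s t : tree) : nat :=
  lent (filtert (fun a => ~~ truthy (hd_tree a) && ~~ memt a t) s) +
  lent (filtert (fun a => ~~ truthy (hd_tree a) && ~~ memt a s) t).

Lemma fpn_ham f g : fp f -> fp g -> fpn (fun t => hamt (f t) (g t)).
Proof.
move=> fP gP; apply: fpn_add; apply: fpn_len.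
  by apply: (@fp_filter (fun t a => ~~ truthy (hd_tree a) && ~~ memt a t)); auto 10 with fp.
by apply: (@fp_filter (fun t a => ~~ truthy (hd_tree a) && ~~ memt a t)); auto 10 with fp.
Qed.

Lemma hamt_list s t : hamt (tree_elems s) (tree_elems t) = ham_list s t.
Proof.
have univE e : ~~ truthy (hd_tree (tree_elem e)) = is_univ e by case: e.
rewrite /hamt /ham_list !filtert_list !lent_list; congr (_ + _); congr size;
  by apply: eq_filter => e; rewrite univE (memt_list tree_elem_inj).
Qed.

(** The value of [m] may be exponential in its length, so only capped values are compared. Below a
    nonpositive bound [h] can only be 0, with bound 0, which the cap 1 detects; otherwise the cap
    [h] decides. *)
Definition leq_boundt (h : nat) (sgn m : tree) : bool :=
  if truthy sgn then (h <= 0) && (minn (bin_val (word_of m)) 1 <= 0)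
  else h <= minn (bin_val (word_of m)) h.

Lemma fpb_leq_bound f g h : fpn f -> fp g -> fp h ->
  fpb (fun t => leq_boundt (f t) (g t) (h t)).
Proof.
move=> fP gP hP.
apply: (@fp_eq (fun t => if truthy (g t) then
  tree_bit ((f t <= 0) && (minn (bin_val (word_of (h t))) 1 <= 0))
  else tree_bit (f t <= minn (bin_val (word_of (h t))) (f t)))).
  by move=> t; rewrite /leq_boundt; case: truthy.
apply: fp_if; auto with fp.
  by apply: fp_bit; apply: fpb_and; apply: fpb_leq; auto with fp; apply: fpn_bin_val; auto with fp.
by apply: fp_bit; apply: fpb_leq; auto with fp; apply: fpn_bin_val.
Qed.

Lemma leq_boundtE h sgn m : leq_boundt h (tree_bit sgn) (tree_word m) =
  (h%:Z <= (-1) ^+ sgn * (bin_val m)%:Z)%R.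
Proof.
rewrite /leq_boundt truthy_bit tree_wordK; case: sgn => /=.
  by rewrite expr1 mulN1r; lia.
by rewrite expr0 mul1r; lia.
Qed.

Lemma decode_wordK t : decode_word (tree_word (code t)) = t.
Proof. exact: dect_codeK. Qed.

Definition verify (r c : nat) (acc : tree -> tree -> bool) (p : {poly nat})
    (x y1 y2 y3 : tree) : bool :=
  let t := decode_word x in let t1 := decode_word y1 in let t3 := decode_word y3 in
  [&& input_ok r c x,
      certifies acc p (field0 t) (hd_tree t1) (tl_tree t1),
      certifies acc p (scenariot (catt (field1 t) (selectt y2 (field2 t))))
        (hd_tree t3) (tl_tree t3)
    & leq_boundt (hamt (hd_tree t1) (hd_tree t3)) (field3 t) (field4 t)].

Lemma fpb_verify r c acc p :
  (forall f g, fp f -> fp g -> fpb (fun t => acc (f t) (g t))) ->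
  fpb (fun q => verify r c acc p (hd_tree q) (field1 q) (field2 q) (field3 q)).
Proof.
move=> accP; rewrite /verify /decode_word.
apply: fpb_and; first by apply: fpb_input_ok; auto with fp.
apply: fpb_and; first by apply: fpb_certifies; auto 10 with fp.
apply: fpb_and.
  by apply: fpb_certifies => //; [apply: fp_scenario| |]; auto 20 with fp.
by apply: fpb_leq_bound; [apply: fpn_ham| |]; auto 10 with fp.
Qed.

Lemma verify_code r c acc p t y1 y2 y3 :
  verify r c acc p (tree_word (code t)) y1 y2 y3 =
  [&& input_ok r c (tree_word (code t)),
      certifies acc p (field0 t) (hd_tree (decode_word y1)) (tl_tree (decode_word y1)),
      certifies acc p (scenariot (catt (field1 t) (selectt y2 (field2 t))))
        (hd_tree (decode_word y3)) (tl_tree (decode_word y3))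
    & leq_boundt (hamt (hd_tree (decode_word y1)) (hd_tree (decode_word y3)))
        (field3 t) (field4 t)].
Proof. by rewrite /verify decode_wordK. Qed.

Lemma select_take w d : select (take (size d) w) d = select w d.
Proof. by elim: d w => //= p d IH [|x w] //=; rewrite IH. Qed.

Lemma select_subseq w d : subseq (select w d) (flatten (dep_parts d)).
Proof.
elim: d w => //= p d IH w; rewrite catA; apply: cat_subseq => //.
by case: (head _ _); rewrite ?prefix_subseq ?suffix_subseq.
Qed.

Lemma solution_languageE P s t : solution_language P (code (Cons s t)) ->
  exists u v, [/\ s = tree_elems u, t = tree_elems v, uniq u && uniq v,
    is_instance P (set_of u) & feasible P (set_of u) (set_of v)].
Proof. by move=> [u [v [/code_inj[-> ->] uv iP fP]]]; exists u, v. Qed.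

Lemma certifies_sound (L : word -> Prop) (V : seq word -> Prop)
    (acc : tree -> tree -> bool) p s t z :
  (forall x, L x <-> alternate true 1 (p.[size x])%R V [:: x]) ->
  (forall u z, acc u z <-> V [:: word_of u; word_of z]) ->
  certifies acc p s t z -> L (code (Cons s t)).
Proof.
move=> LP accP; rewrite /certifies enct_code lent_list LP.
move=> /andP[zp /accP]; rewrite tree_wordK => Vz.
by exists (word_of z); rewrite size_word_of.
Qed.

Lemma certifies_word (L : word -> Prop) (V : seq word -> Prop)
    (acc : tree -> tree -> bool) p s t :
  (forall x, L x <-> alternate true 1 (p.[size x])%R V [:: x]) ->
  (forall u z, acc u z <-> V [:: word_of u; word_of z]) ->
  L (code (Cons s t)) -> exists2 z : word, certifies acc p s t (tree_word z)
    & size z <= (p.[(tree_size s + tree_size t).+1])%R.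
Proof.
move=> LP accP; rewrite /certifies enct_code lent_list LP => -[z [zp Vz]].
exists z; first by rewrite lent_list zp; apply/accP; rewrite !tree_wordK.
by rewrite -[_.+1]/(tree_size (Cons s t)) -size_code.
Qed.

(** By [feasible_sub] a solution lies inside its instance, so any enumeration of it is no larger
    than the list [l]. This bounds the length of the existential witnesses. *)
Lemma feasible_seq P (l : seq elem) S : is_instance P (set_of l) ->
  feasible P (set_of l) S -> uniq l ->
  exists t, [/\ S = set_of t, uniq t & tree_size (tree_elems t) <= tree_size (tree_elems l)].
Proof.
move=> iP fP lu; exists (enum_fset S).
have uS : uniq (enum_fset S) by exact: fset_uniq.
split=> //; first by apply/fsetP => x; rewrite mem_set_of.
apply: tree_size_list_sub => // x xS.
by rewrite -mem_set_of; apply: (fsubsetP (feasible_sub iP fP)).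
Qed.

Theorem theorem14 (P : comb_problem) (c : nat) (hP : problem_in_NP P) :
  Sigma_p 3 (HDRR_xor_language P c).
Proof.
have [_ [V [p [/fpb_polytime[acc accP acc_fp] LP]]]] := hP.
(* With [n] the input length, a witness [Cons t (tree_word z)] has at most [n] nodes for [t], one on
   top and [4 * size z + 1] for [z]. The length of [z] is at most [p] at the length of the code of
   [Cons s t], and that length is at most [2 * n + 1]. *)
pose Q := ('X + 3%:P + 4%:P * (p \Po (2%:P * 'X + 1)))%R : {poly nat}.
have QE n : (Q.[n])%R = n + 3 + 4 * (p.[(2 * n + 1)%N])%R.
  by rewrite /Q !(hornerD, hornerCM, hornerX, hornerC, horner_comp).
exists (fun ws => let q := tree_list tree_word ws in
  verify (nrel P) c acc p (field0 q) (field1 q) (field2 q) (field3 q)), Q; split.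
  exact: (polytime_fpb 4 (fpb_verify (nrel P) c p acc_fp)).
move=> w; rewrite QE /=; set m := (_ + 4 * _).
have cert_size (t : tree) (z : word) (s : tree) :
    tree_size t <= tree_size s -> tree_size s <= size w ->
    size z <= (p.[(tree_size s + tree_size t).+1])%R ->
    size (code (Cons t (tree_word z))) <= m.
  move=> ts sw zp; rewrite size_code /=.
  have : (p.[(tree_size s + tree_size t).+1])%R <= (p.[(2 * size w + 1)%N])%R.
    by apply: horner_leq; lia.
  move: zp; rewrite /m; move: (p.[_])%R (p.[_])%R => A B; have := tree_size_word z; lia.
split.
  move=> [b [e [d [sgn [k [wE dc /andP[ub ue] /andP[ce dis] [ib isg [s0 [fs0 rec]]]]]]]]].
  have uparts : uniq (flatten (e :: dep_parts d)).
    by rewrite uniq_flatten_disjoint ue dis.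
  have sw : tree_size (tree_elems b) <= size w /\
      tree_size (tree_elems e) + tree_size (tree_deps d) <= size w.
    by rewrite wE size_code /= -/(tree_deps d); lia.
  have [t0 [s0E ut0 t0b]] := feasible_seq ib fs0 ub.
  have /(certifies_word LP accP)[z0 z0P z0s] :
      solution_language P (code (Cons (tree_elems b) (tree_elems t0))).
    by exists b, t0; rewrite ub ut0 -s0E.
  exists (code (Cons (tree_elems t0) (tree_word z0))); split.
    by apply: cert_size z0s => //; case: sw.
  move=> y _.
  (* The lists exactly as the verifier computes them: the certificate has to be found for [sg], not
     for another enumeration of the same scenario. *)
  pose l := e ++ select y d; pose sg := scenario_seq l.
  have lE : catt (tree_elems e) (selectt (tree_word y) (tree_deps d)) = tree_elems l.
    by rewrite selectt_deps catt_list.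
  have sgE : set_of sg = scenario (set_of l) by rewrite scenario_list.
  have xsg : xor_scenarios (set_of e) (dep_sets d) (set_of sg).
    (* [y] may be longer than the list of dependencies; truncation does not alter the selection. *)
    rewrite sgE; apply/xor_scenariosP; exists (take (size d) y).
      by rewrite size_take; case: ltnP.
    by rewrite select_take.
  have usg : uniq sg.
    apply: filter_uniq; apply: subseq_uniq uparts.
    by rewrite /= cat_subseq // select_subseq.
  have [S [fS hS]] := rec _ xsg.
  have [t [SE ut ts]] := feasible_seq (isg _ xsg) fS usg.
  have /(certifies_word LP accP)[z zP zs] :
      solution_language P (code (Cons (tree_elems sg) (tree_elems t))).
    by exists sg, t; rewrite usg ut -SE; split=> //; exact: isg.
  have ssg : tree_size (tree_elems sg) <= size w.
    rewrite -scenariot_list; apply: leq_trans (tree_size_filter _ _) _.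
    rewrite -lE.
    have := tree_size_cat (tree_elems e) (selectt (tree_word y) (tree_deps d)).
    by have := tree_size_select (tree_word y) (tree_deps d); lia.
  exists (code (Cons (tree_elems t) (tree_word z))); split; first exact: cert_size zs.
  have input : input_ok (nrel P) c (tree_word w).
    apply/input_okP; exists (tree_elems b), e, d, sgn, k; split=> //.
  rewrite /= -[X in is_true X]/(verify (nrel P) c acc p (tree_word w)
    (tree_word (code (Cons (tree_elems t0) (tree_word z0)))) (tree_word y)
    (tree_word (code (Cons (tree_elems t) (tree_word z))))).
  rewrite wE in input *; rewrite verify_code input !decode_wordK.
  rewrite -[field1 _]/(tree_elems e) -[field2 _]/(tree_deps d) lE scenariot_list -/sg.
  apply/and4P; split=> //.
  rewrite -[X in is_true X]/(leq_boundt (hamt (tree_elems t0) (tree_elems t))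
    (tree_bit sgn) (tree_word k)).
  by rewrite leq_boundtE hamt_list -hamming_list // -s0E -SE.
move=> [y1 [_ H]].
(* The tests of the input and of the base solution stand under the universal quantifier but do not
   depend on the choices; the empty word is one instance that yields both. *)
have [_ [_ /and4P[/input_okP[tb [e [d [sgn [k [wE dc u co]]]]]] base _ _]]] := H [::] isT.
have decE : decode_word (tree_word w) =
    Cons tb (Cons (tree_elems e) (Cons (tree_deps d) (Cons (tree_bit sgn) (tree_word k)))).
  by rewrite wE decode_wordK.
rewrite decE in base.
have [b [t0 [bE t0E /andP[ub ut0] ib fb]]] :=
  solution_languageE (certifies_sound LP accP base).
have dw : size d <= m.
  by rewrite /m wE size_code /=; have := size_deps d; lia.
(* [is_instance] is extracted along with the solution: [HDRR] requires it of every scenario, and the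
   certificate is its only source. *)
have rec sigma : xor_scenarios (set_of e) (dep_sets d) sigma -> exists s,
    [/\ is_instance P sigma, feasible P sigma s
      & ((hamming (set_of t0) s)%:Z <= (-1) ^+ sgn * (bin_val k)%:Z)%R].
  move=> /xor_scenariosP[y2 y2d ->].
  have [y3 [_ /and4P[_ _ cert bound]]] := H y2 (leq_trans y2d dw).
  rewrite decE -[field1 _]/(tree_elems e) -[field2 _]/(tree_deps d) in cert.
  rewrite selectt_deps catt_list scenariot_list in cert.
  have [sg [t [/tree_elems_inj sgE tE /andP[_ ut] isg fs]]] :=
    solution_languageE (certifies_sound LP accP cert).
  exists (set_of t); rewrite scenario_list -/(scenario_seq _) sgE; split=> //.
  by move: bound; rewrite decE t0E tE leq_boundtE hamt_list -hamming_list.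
have [ue dis] : all uniq (e :: dep_parts d) /\
    pairwise (fun s t => [disjoint set_of s & set_of t]%fset) (e :: dep_parts d).
  by apply/andP; rewrite -uniq_flatten_disjoint.
exists b, e, d, sgn, k; split=> //.
- by rewrite wE -bE.
- by rewrite ub.
- by apply/andP; split.
split=> // [sigma /rec[s []] //|].
by exists (set_of t0); split=> // sigma /rec[s [_ fs le]]; exists s.
Qed.
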